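(* Let $\mathfrak X_0$ be an integral normal scheme with function field $K_0$ and let $C$ be an algebraically closed field such that $C^\times\neq\mu(C)$, $\mathrm{card}\,K_0\le\mathrm{card}\,C$, and either $\mathrm{char}\,C=0$ or $\mathrm{char}\,K_0=\mathrm{char}\,C>0$. Let $\mathcal E$ be an admissible class of characters with $\mathcal E\subset\mathcal E_{\max}$ and let $X_0=\check{\mathfrak X}_0(C)_{\mathcal E}\times_{\mathbb Q_0^{>0}}\mathbb R^{>0}$. Then $$\{x_0\in X_0\mid(\mathbb R^{>0})_{x_0}\ne1\}=\coprod_{\mathfrak x_0}\Gamma^{\mathcal E}_{\mathfrak x_0},$$ where $\mathfrak x_0$ runs over the points of $\mathfrak X_0$ with finite residue field $\kappa(\mathfrak x_0)$. For any point $x_0\in\Gamma^{\mathcal E}_{\mathfrak x_0}$ the isotropy group of $x_0$ is $(\mathbb R^{>0})_{x_0}=(N\mathfrak x_0)^{\mathbb Z}$, where $N\mathfrak x_0=|\kappa(\mathfrak x_0)|$.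
   Context: Let $K$ be an algebraic closure of $K_0$, $\mathfrak X$ the normalization of $\mathfrak X_0$ in $K$, and $G=\mathrm{Aut}_{K_0}(K)$, acting on $\mathfrak X$ from the right over $\mathfrak X_0$ (with induced isomorphisms $\sigma:\kappa(x^\sigma)\to\kappa(x)$). $\mathcal N$ is the multiplicative monoid of positive integers; $\mathcal N_0\subset\mathcal N$ is the submonoid generated by a set $\mathrm{char}\,\mathcal N_0$ of primes containing the set $\mathrm{char}\,\mathfrak X_0$ of positive residue characteristics of points of $\mathfrak X_0$; $\mathbb Q_0^{>0}\subset\mathbb Q^{>0}$ is the subgroup generated by $\mathcal N_0$. $\dot{\mathfrak X}(C)$ is the set of pairs $(x,\bar P^\times)$, $x\in\mathfrak X$, $\bar P^\times:\kappa(x)^\times\to C^\times$ a group homomorphism (character), with $(x,\bar P^\times)^\sigma=(x^\sigma,\bar P^\times\circ\sigma)$ for $\sigma\in G$ and injective commuting maps $F_\nu(x,\bar P^\times)=(x,\bar P^\times\circ(\ )^\nu)$. Classes of characters: a class $\mathcal E$ of characters $\chi:\kappa^\times\to C^\times$ on algebraically closed fields $\kappa$ is admissible if it is invariant under isomorphisms $\tau:\kappa'\to\kappa$ of fields ($\chi\in\mathcal E\Leftrightarrow\chi\circ\tau\in\mathcal E$), if $\chi\in\mathcal E\Leftrightarrow\chi^\nu\in\mathcal E$ for all $\nu\in\mathcal N_0$, and if every $\chi\in\mathcal E$ satisfies (Tors): $\ker(\chi)_{\mathrm{tors}}$ is finite of order in $\mathcal N_0$. $\mathcal E_{\mathrm{tors}}$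 is the class of all characters satisfying (Tors). $\mathcal E_{\max}$ is the class of characters satisfying (Tors) and (Image): if $\mathrm{char}\,\kappa>0$ and $\chi(\kappa^\times)$ is torsion, then $\kappa^\times$ is torsion. $\dot{\mathfrak X}(C)_{\mathcal E}$ is the set of $(x,\bar P^\times)\in\dot{\mathfrak X}(C)$ with $\bar P^\times\in\mathcal E$; $\check{\mathfrak X}(C)_{\mathcal E}=\mathrm{colim}_{\mathcal N_0}\dot{\mathfrak X}(C)_{\mathcal E}$ (colimit over $\mathcal N_0$ ordered by divisibility, transition map from index $\nu$ to $\nu\mu$ being $F_\mu$), on which the $F_\nu$, $\nu\in\mathcal N_0$, become bijective and define an action of $\mathbb Q_0^{>0}$; its points are written $F_\nu^{-1}P$ with $\nu\in\mathcal N_0$, $P\in\dot{\mathfrak X}(C)_{\mathcal E}$. $\check{\mathfrak X}_0(C)_{\mathcal E}=\check{\mathfrak X}(C)_{\mathcal E}/G$ with induced $\mathbb Q_0^{>0}$-action. The map $F_\nu^{-1}(x,\bar P^\times)\mapsto\pi(x)$ ($\pi:\mathfrak X\to\mathfrak X_0$) induces $\mathrm{pr}_{\mathfrak X_0}:\check{\mathfrak X}_0(C)_{\mathcal E}\to\mathfrak X_0$. $\check{\mathfrak X}_0(C)_{\mathcal E}\times_{\mathbb Q_0^{>0}}\mathbb R^{>0}$ is the quotient of $\check{\mathfrak X}_0(C)_{\mathcal E}\times\mathbb R^{>0}$ by the action $(P_0,u)q=(F_q(P_0),q^{-1}u)$ of $\mathbb Q_0^{>0}$, with $\mathbb R^{>0}$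 acting by $[P_0,u]\cdot v=[P_0,uv]$; $(\mathbb R^{>0})_{x_0}$ is the stabilizer of $x_0$. For $\mathfrak x_0\in\mathfrak X_0$ with finite residue field let $C_{\mathfrak x_0}=\mathrm{pr}_{\mathfrak X_0}^{-1}(\mathfrak x_0)\subset\check{\mathfrak X}_0(C)_{\mathcal E_{\mathrm{tors}}}$, $C^{\mathcal E}_{\mathfrak x_0}=C_{\mathfrak x_0}\cap\check{\mathfrak X}_0(C)_{\mathcal E}$ and $\Gamma^{\mathcal E}_{\mathfrak x_0}=C^{\mathcal E}_{\mathfrak x_0}\times_{\mathbb Q_0^{>0}}\mathbb R^{>0}\subset X_0$. *)

(* Defs.v *)
From HB Require Import structures.
From mathcomp Require Import all_boot all_order all_algebra.
From mathcomp Require Import finmap ring_quotient interval_inference.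
From mathcomp Require Import all_classical all_reals topology.

Set Implicit Arguments.
Unset Strict Implicit.
Unset Printing Implicit Defensive.

Import Order.TTheory GRing.Theory Num.Theory.
Local Open Scope classical_set_scope.
Local Open Scope card_scope.
Local Open Scope ring_scope.
Local Open Scope quotient_scope.

(** * Local subrings of a field and their residue fields *)

Record local_subring (K : fieldType) := LocalSubring {
  lsub_mem :> {pred K};
  lsub_closed : subring_closed lsub_mem;
  lsub_local : forall a b : K, a \in lsub_mem -> b \in lsub_mem ->
    a + b != 0 -> (a + b)^-1 \in lsub_mem ->
    (a != 0 /\ a^-1 \in lsub_mem) \/ (b != 0 /\ b^-1 \in lsub_mem) }.

HB.instance Definition _ (K : fieldType) (A : local_subring K) :=
  GRing.isSubringClosed.Build K (lsub_mem A) (lsub_closed A).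

Record lsub (K : fieldType) (A : local_subring K) : predArgType :=
  LSub { lsub_val : K; lsub_valP : lsub_val \in lsub_mem A }.

Section LsubRing.
Context (K : fieldType) (A : local_subring K).

HB.instance Definition _ := [isSub for @lsub_val K A].
HB.instance Definition _ := [Choice of lsub A by <:].
HB.instance Definition _ := [SubChoice_isSubComNzRing of lsub A by <:].

Definition lsub_nonunit : {pred lsub A} :=
  fun a => (val a == 0) || ((val a)^-1 \notin lsub_mem A).

Lemma lsub_nonunitE a :
  (a \in lsub_nonunit) = (val a == 0) || ((val a)^-1 \notin lsub_mem A).
Proof. by []. Qed.

Lemma lsub_nonunit_add :
  {in lsub_nonunit &, forall a b, a + b \in lsub_nonunit}.
Proof.
move=> a b; rewrite !lsub_nonunitE => ha hb.
apply/negPn/negP; rewrite negb_or negbK => /andP[].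
rewrite rmorphD => h0 h1.
case: (lsub_local (valP a) (valP b) h0 h1) => -[n0 n1].
  by case/orP: ha => [e|]; [rewrite e in n0|rewrite n1].
by case/orP: hb => [e|]; [rewrite e in n0|rewrite n1].
Qed.

Lemma lsub_nonunit_mul a b : b \in lsub_nonunit -> a * b \in lsub_nonunit.
Proof.
rewrite !lsub_nonunitE; have -> : val (a * b) = val a * val b by [].
case/orP => [/eqP ->|hb]; first by rewrite mulr0 eqxx.
have [//|n0 /=] := boolP (val a * val b == 0).
apply: contra hb => h; move: n0; rewrite mulf_eq0 negb_or => /andP[a0 b0].
have -> : (val b)^-1 = val a * (val a * val b)^-1.
  by rewrite invfM mulrA divff // mul1r.
by rewrite rpredM //; exact: valP.
Qed.

Lemma lsub_nonunit_ideal : idealr_closed lsub_nonunit.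
Proof.
split=> [||a b c hb hc]; first by rewrite lsub_nonunitE /= eqxx.
  by rewrite lsub_nonunitE rmorph1 oner_eq0 invr1 rpred1.
exact/lsub_nonunit_add/hc/lsub_nonunit_mul.
Qed.

HB.instance Definition _ :=
  isIdealr.Build (lsub A) lsub_nonunit lsub_nonunit_ideal.

Definition residue_field := {ideal_quot lsub_nonunit}.

HB.instance Definition _ := GRing.ComNzRing.on residue_field.

Definition residue_inv (x : residue_field) : residue_field :=
  if x == 0 then 0
  else \pi_(residue_field) (insubd (0 : lsub A) (val (repr x))^-1).

Lemma residue_mulVf (x : residue_field) : x != 0 -> residue_inv x * x = 1.
Proof.
move=> x0; rewrite /residue_inv (negPf x0); move: x0.
rewrite -{1 3}[x]reprK; set a := repr x => a0.
have : a \notin lsub_nonunit.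
  apply: contra a0 => ha; rewrite -(rmorph0 \pi_(residue_field)).
  by apply/eqP/eqmodP; rewrite /= Quotient.equivE subr0.
rewrite lsub_nonunitE negb_or negbK => /andP[va0 vaA].
rewrite -rmorphM -(rmorph1 \pi_(residue_field)); congr (\pi _).
by apply/val_inj; rewrite rmorphM rmorph1 /= insubdK // mulVf.
Qed.

Lemma residue_inv0 : residue_inv 0 = 0.
Proof. by rewrite /residue_inv eqxx. Qed.

HB.instance Definition _ := GRing.ComNzRing_isField.Build residue_field
  residue_mulVf residue_inv0.

(* Reduction modulo the maximal ideal, extended by 0 outside A. *)
Definition residue (a : K) : residue_field :=
  \pi_(residue_field) (insubd (0 : lsub A) a).

End LsubRing.

(** * Schemes *)

Record opens (X : topologicalType) :=
  Opens { opens_set :> X -> Prop; opens_open : open opens_set }.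

Definition nonempty (X : topologicalType) (U : opens X) : Prop :=
  exists x : X, U x.

Definition opensI (X : topologicalType) (U V : opens X) : opens X :=
  Opens (openI (opens_open U) (opens_open V)).

Lemma opens_pre_subproof (X Y : topologicalType) (f : X -> Y)
  (fc : continuous f) (V : opens Y) : open (f @^-1` opens_set V).
Proof. by apply: open_comp (opens_open V) => x _; exact: fc. Qed.

Definition opens_pre (X Y : topologicalType) (f : X -> Y) (fc : continuous f)
  (V : opens Y) : opens X := Opens (opens_pre_subproof fc V).

(* The section ring over the empty set is the zero ring, whence pzRings. *)
Record ringed_space := RingedSpace {
  rs_space :> topologicalType;
  sec : opens rs_space -> comPzRingType;
  res : forall U V : opens rs_space,
    opens_set V `<=` opens_set U -> {rmorphism sec U -> sec V};
  res_id : forall (U : opens rs_space) (h : opens_set U `<=` opens_set U)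
    (s : sec U), res h s = s;
  res_comp : forall (U V W : opens rs_space)
    (h : opens_set V `<=` opens_set U) (k : opens_set W `<=` opens_set V)
    (l : opens_set W `<=` opens_set U) (s : sec U), res k (res h s) = res l s;
  res_sheaf : forall (I : Type) (W : opens rs_space) (U : I -> opens rs_space)
    (h : forall i, opens_set (U i) `<=` opens_set W),
    opens_set W `<=` \bigcup_i opens_set (U i) ->
    forall s : forall i, sec (U i),
    (forall i j,
      res (V := opensI (U i) (U j)) (@subIsetl _ (U i) (U j)) (s i)
      = res (V := opensI (U i) (U j)) (@subIsetr _ (U i) (U j)) (s j)) ->
    exists! t : sec W, forall i, res (h i) t = s i }.

(* The germ of [s] at [x] is a unit of the stalk at [x]. *)
Definition germ_unit (X : ringed_space) (U : opens X) (s : sec U) (x : X) :=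
  exists (V : opens X) (h : opens_set V `<=` opens_set U),
    V x /\ exists t : sec V, res h s * t = 1.

(* All stalks are local rings: they are nonzero and a sum of two nonunits is a
   nonunit. *)
Record locally_ringed (X : ringed_space) : Prop := LocallyRinged {
  stalk_nonzero : forall (U : opens X) (x : X), U x ->
    ~ germ_unit (0 : sec U) x;
  stalk_local : forall (U : opens X) (s t : sec U) (x : X), U x ->
    germ_unit (s + t) x -> germ_unit s x \/ germ_unit t x }.

Definition basic_set (X : ringed_space) (U : opens X) (s : sec U) : set X :=
  [set x | U x /\ germ_unit s x].

Lemma basic_set_open (X : ringed_space) (U : opens X) (s : sec U) :
  open (basic_set s).
Proof.
rewrite openE => x [_ [V [h [Vx [t st]]]]].
apply: (@filterS _ (nbhs x) _ V); last first.
  exact/open_nbhs_nbhs/(conj (opens_open V)).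
by move=> y Vy; split; [exact: (h y Vy)|exists V, h; split=> //; exists t].
Qed.

Definition basic_open (X : ringed_space) (U : opens X) (s : sec U) : opens X :=
  Opens (basic_set_open s).

Lemma basic_open_sub (X : ringed_space) (U : opens X) (s : sec U) :
  opens_set (basic_open s) `<=` opens_set U.
Proof. by move=> x []. Qed.

Record prime_ideal (A : comPzRingType) (p : set A) : Prop := PrimeIdeal {
  prime_ideal0 : p 0;
  prime_idealD : forall a b, p a -> p b -> p (a + b);
  prime_idealZ : forall a b, p b -> p (a * b);
  prime_ideal1 : ~ p 1;
  prime_idealM : forall a b, p (a * b) -> p a \/ p b }.

(* In a locally ringed space, [U] is an affine open iff the canonical morphism
   U -> Spec O(U), sending x to the prime of the sections whose germ at x is not
   a unit, is an isomorphism of ringed spaces.  The four fields say that it is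
   bijective, that the opens D(s), which are the preimages of the distinguished
   opens, form a basis of the topology of U, and that
   O(U)[1/s] -> O(D(s)) is surjective, resp. injective. *)
Record affine_open (X : ringed_space) (U : opens X) : Prop := AffineOpen {
  affine_bij : forall p : set (sec U), prime_ideal p ->
    exists! x : X, U x /\ p = [set s | ~ germ_unit s x];
  affine_basis : forall (V : opens X) (x : X), U x -> V x ->
    exists s : sec U,
      basic_open s x /\ opens_set (basic_open s) `<=` opens_set V;
  affine_surj : forall (s : sec U) (t : sec (basic_open s)),
    exists (n : nat) (a : sec U),
      t * res (@basic_open_sub X U s) s ^+ n = res (@basic_open_sub X U s) a;
  affine_inj : forall s a : sec U, res (@basic_open_sub X U s) a = 0 ->
    exists n : nat, s ^+ n * a = 0 }.

Record scheme := Scheme {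
  sch_rs :> ringed_space;
  sch_local : locally_ringed sch_rs;
  sch_affine : forall x : sch_rs,
    exists U : opens sch_rs, U x /\ affine_open U }.

Record integral_scheme (X : scheme) : Prop := IntegralScheme {
  integral_nonempty : exists x : X, True;
  integral_neq0 : forall U : opens X, nonempty U -> (1 : sec U) <> 0;
  integral_mul : forall U : opens X, nonempty U -> forall s t : sec U,
    s * t = 0 -> s = 0 \/ t = 0 }.

Record morphism (X Y : scheme) := Morphism {
  mor_fun :> X -> Y;
  mor_cont : continuous mor_fun;
  mor_sec : forall V : opens Y, {rmorphism sec V -> sec (opens_pre mor_cont V)};
  mor_res : forall (V W : opens Y) (h : opens_set W `<=` opens_set V)
    (k : opens_set (opens_pre mor_cont W) `<=` opens_set (opens_pre mor_cont V))
    (s : sec V), mor_sec W (res h s) = res k (mor_sec V s);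
  mor_local : forall (V : opens Y) (s : sec V) (x : X), V (mor_fun x) ->
    germ_unit (mor_sec V s) x -> germ_unit s (mor_fun x) }.

Definition mor_pre (X Y : scheme) (f : morphism X Y) (V : opens Y) : opens X :=
  opens_pre (@mor_cont X Y f) V.

(* [K] is the function field of the integral scheme [X], i.e. the stalk at the
   generic point.  The generic point lies in every nonempty open and the
   restriction maps between these are injective, so the colimit of the O(U)
   is a union. *)
Record function_field (X : scheme) (K : fieldType) := FunctionField {
  germ : forall U : opens X, nonempty U -> {rmorphism sec U -> K};
  germ_res : forall (U V : opens X) (nU : nonempty U) (nV : nonempty V)
    (h : opens_set V `<=` opens_set U) (s : sec U),
    germ nV (res h s) = germ nU s;
  germ_inj : forall (U : opens X) (nU : nonempty U), injective (germ nU);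
  germ_surj : forall a : K, exists (U : opens X) (nU : nonempty U) (s : sec U),
    germ nU s = a }.

Section Stalks.
Context (X : scheme) (K : fieldType) (F : function_field X K).

Definition stalk_mem (x : X) : {pred K} := fun a =>
  `[< exists (U : opens X) (nU : nonempty U) (s : sec U),
        U x /\ germ F nU s = a >].

Lemma stalk_memP (x : X) (a : K) :
  reflect (exists (U : opens X) (nU : nonempty U) (s : sec U),
             U x /\ germ F nU s = a) (a \in stalk_mem x).
Proof. exact: asboolP. Qed.

Lemma stalk_mem2 (x : X) (a b : K) : a \in stalk_mem x -> b \in stalk_mem x ->
  exists (U : opens X) (nU : nonempty U) (s t : sec U),
    [/\ U x, germ F nU s = a & germ F nU t = b].
Proof.
move=> /stalk_memP[U [nU [s [Ux <-]]]] /stalk_memP[V [nV [t [Vx <-]]]].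
have nW : nonempty (opensI U V) by exists x.
exists (opensI U V), nW, (res (V := opensI U V) (@subIsetl _ U V) s),
  (res (V := opensI U V) (@subIsetr _ U V) t).
by rewrite !germ_res.
Qed.

Lemma stalk_closed (x : X) : subring_closed (stalk_mem x).
Proof.
split=> [|a b ha hb|a b ha hb].
- have [U [Ux _]] := sch_affine x.
  have nU : nonempty U by exists x.
  by apply/stalk_memP; exists U, nU, 1; rewrite rmorph1.
- have [U [nU [s [t [Ux <- <-]]]]] := stalk_mem2 ha hb.
  by apply/stalk_memP; exists U, nU, (s - t); rewrite rmorphB.
- have [U [nU [s [t [Ux <- <-]]]]] := stalk_mem2 ha hb.
  by apply/stalk_memP; exists U, nU, (s * t); rewrite rmorphM.
Qed.

Lemma germ_unitP (U : opens X) (nU : nonempty U) (s : sec U) (x : X) : U x ->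
  germ_unit s x <->
  germ F nU s != 0 /\ (germ F nU s)^-1 \in stalk_mem x.
Proof.
move=> Ux; split=> [[V [h [Vx [t st]]]]|[s0 /stalk_memP[V [nV [t [Vx ts]]]]]].
  have nV : nonempty V by exists x.
  have : germ F nU s * germ F nV t = 1.
    by rewrite -(germ_res F nU nV h) -rmorphM st rmorph1.
  move=> e; have s0 : germ F nU s != 0.
    by apply: contra_eq_neq e => ->; rewrite mul0r eq_sym oner_neq0.
  split=> //; apply/stalk_memP; exists V, nV, t; split=> //.
  by apply: (mulfI s0); rewrite e divff.
have nW : nonempty (opensI U V) by exists x.
exists (opensI U V), (@subIsetl _ U V); split=> //.
exists (res (V := opensI U V) (@subIsetr _ U V) t).
apply: (@germ_inj _ _ F _ nW); rewrite rmorphM rmorph1.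
by rewrite (germ_res F nU nW) (germ_res F nV nW) ts divff.
Qed.

Lemma stalk_mem_local (x : X) (a b : K) :
  a \in stalk_mem x -> b \in stalk_mem x ->
  a + b != 0 -> (a + b)^-1 \in stalk_mem x ->
  (a != 0 /\ a^-1 \in stalk_mem x) \/ (b != 0 /\ b^-1 \in stalk_mem x).
Proof.
move=> ha hb; have [U [nU [s [t [Ux <- <-]]]]] := stalk_mem2 ha hb.
rewrite -rmorphD => h0 h1.
have /(stalk_local (sch_local X) Ux) : germ_unit (s + t) x.
  exact/(germ_unitP nU).
by case=> /(germ_unitP nU _ Ux); [left|right].
Qed.

(* The local ring at [x], embedded in the function field. *)
Definition stalk (x : X) : local_subring K :=
  LocalSubring (stalk_closed x) (@stalk_mem_local x).

Definition kappa (x : X) : fieldType := residue_field (stalk x).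

End Stalks.

Definition integral_over (K : fieldType) (S : set K) (a : K) : Prop :=
  exists p : {poly K}, [/\ p \is monic, forall i, S p`_i & root p a].

(* The local rings are integrally closed in their fraction field, which is the
   function field. *)
Definition normal_scheme (X : scheme) (K : fieldType)
  (F : function_field X K) : Prop :=
  forall (x : X) (a : K),
    integral_over [set b | b \in stalk F x] a -> a \in stalk F x.

(* The normalization of [X0] in [K]: the relative spectrum over [X0] of the
   integral closure of O_X0 in the constant algebra [K]. *)
Record normalization (X0 : scheme) (K0 : fieldType) (F0 : function_field X0 K0)
    (K : fieldType) (iota : {rmorphism K0 -> K}) := Normalization {
  nz_scheme :> scheme;
  nz_integral : integral_scheme nz_scheme;
  nz_field : function_field nz_scheme K;
  nz_proj : morphism nz_scheme X0;
  nz_proj_germ : forall (U : opens X0) (nU : nonempty U)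
    (nV : nonempty (mor_pre nz_proj U)) (s : sec U),
    germ nz_field nV (mor_sec nz_proj U s) = iota (germ F0 nU s);
  nz_affine : forall U : opens X0, nonempty U -> affine_open U ->
    affine_open (mor_pre nz_proj U);
  nz_closure : forall (U : opens X0) (nU : nonempty U), affine_open U ->
    forall a : K,
      (exists (nV : nonempty (mor_pre nz_proj U))
         (t : sec (mor_pre nz_proj U)), germ nz_field nV t = a)
      <-> integral_over [set iota (germ F0 nU s) | s in [set: sec U]] a }.

(** * Galois action *)

Record galois (K0 K : fieldType) (iota : {rmorphism K0 -> K}) := Galois {
  gal :> {rmorphism K -> K};
  gal_inv : {rmorphism K -> K};
  galK : cancel gal gal_inv;
  galVK : cancel gal_inv gal;
  gal_fix : forall a : K0, gal (iota a) = iota a }.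

Lemma rmorphism_ext (A B : fieldType) (f g : {rmorphism A -> B}) :
  f =1 g -> f = g.
Proof.
case: f g => [f [[f1] [f2]]] [g [[g1] [g2]]] /= /funext e.
case: g / e g1 g2 => g1 g2.
by rewrite (Prop_irrelevance f1 g1) (Prop_irrelevance f2 g2).
Qed.

Section GaloisGroup.
Context (K0 K : fieldType) (iota : {rmorphism K0 -> K}).
Implicit Types sigma tau : galois iota.

Lemma galois_ext sigma tau : sigma =1 tau -> sigma = tau.
Proof.
case: sigma tau => [f f' fK f'K fF] [g g' gK g'K gF] /= e.
have e' : f' = g'.
  by apply: rmorphism_ext => a; rewrite -[in LHS](g'K a) -e fK.
have {e} := rmorphism_ext e => e.
case: g / e gK g'K gF; case: g' / e' => *.
by congr Galois; exact: Prop_irrelevance.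
Qed.

Definition galois1 : galois iota := @Galois K0 K iota
  idfun idfun (fun=> erefl) (fun=> erefl) (fun=> erefl).

Lemma galoisV_fix sigma (a : K0) : gal_inv sigma (iota a) = iota a.
Proof. by rewrite -[in LHS](gal_fix sigma a) galK. Qed.

Definition galoisV sigma : galois iota :=
  Galois (galVK sigma) (galK sigma) (galoisV_fix sigma).

Lemma galoisM_fix sigma tau (a : K0) : (sigma \o tau) (iota a) = iota a.
Proof. by rewrite /= !gal_fix. Qed.

Definition galoisM sigma tau : galois iota := @Galois K0 K iota
  (sigma \o tau) (gal_inv tau \o gal_inv sigma)
  (can_comp (galK sigma) (galK tau)) (can_comp (galVK tau) (galVK sigma))
  (galoisM_fix sigma tau).

Lemma galoisMV sigma : galoisM sigma (galoisV sigma) = galois1.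
Proof. by apply: galois_ext => a /=; rewrite galVK. Qed.

End GaloisGroup.

(* The right action of [galois iota] on the normalization over [X0]; the
   automorphism x |-> x^sigma induces [sigma] on the function field. *)
Record galois_action (X0 : scheme) (K0 : fieldType) (F0 : function_field X0 K0)
    (K : fieldType) (iota : {rmorphism K0 -> K}) (X : normalization F0 iota) :=
  GaloisAction {
  gact :> galois iota -> morphism X X;
  gact1 : forall x : X, gact (galois1 iota) x = x;
  gactM : forall (sigma tau : galois iota) (x : X),
    gact (galoisM sigma tau) x = gact tau (gact sigma x);
  gact_over : forall (sigma : galois iota) (x : X),
    nz_proj X (gact sigma x) = nz_proj X x;
  gact_germ : forall (sigma : galois iota) (U : opens X) (nU : nonempty U)
    (nV : nonempty (mor_pre (gact sigma) U)) (s : sec U),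
    germ (nz_field X) nV (mor_sec (gact sigma) U s)
    = sigma (germ (nz_field X) nU s) }.

(** * Characters *)

(* A group homomorphism k^* -> C^*, encoded as its extension by 0 to all of k;
   multiplicativity makes it nonzero on k^*. *)
Record character (k C : fieldType) := Character {
  chi_fun :> k -> C;
  chi0 : chi_fun 0 = 0;
  chi1 : chi_fun 1 = 1;
  chiM : {morph chi_fun : x y / x * y} }.

Lemma characterP (k C : fieldType) (chi psi : character k C) :
  chi =1 psi -> chi = psi.
Proof.
case: chi psi => [f f0 f1 fM] [g g0 g1 gM] /= /funext e.
by case: g / e g0 g1 gM => *; congr Character; exact: Prop_irrelevance.
Qed.

Record prime_set := PrimeSet {
  pset :> nat -> Prop;
  pset_prime : forall p, pset p -> prime p }.

Definition generated (P : prime_set) (n : nat) : Prop :=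
  exists2 s : seq nat, (forall p, p \in s -> P p) & n = (\prod_(p <- s) p)%N.

(* The submonoid of the multiplicative monoid of positive integers generated
   by [P]. *)
Record submonoid (P : prime_set) := Submonoid {
  sm_val :> nat;
  sm_gen : generated P sm_val }.

Section Submonoid.
Context (P : prime_set).
Implicit Types m n : submonoid P.

Lemma sm_gt0 n : (0 < n)%N.
Proof.
case: n => m [s hs e] /=; rewrite e big_seq prodn_cond_gt0 // => p /hs.
by move=> /pset_prime/prime_gt0.
Qed.

Lemma sm1_gen : generated P 1.
Proof. by exists [::]; rewrite ?big_nil. Qed.

Definition sm1 : submonoid P := Submonoid sm1_gen.

Lemma smM_gen m n : generated P (m * n).
Proof.
case: (sm_gen m) (sm_gen n) => [s hs ->] [t ht ->].
exists (s ++ t); last by rewrite big_cat.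
by move=> p; rewrite mem_cat => /orP[/hs|/ht].
Qed.

Definition smM m n : submonoid P := Submonoid (smM_gen m n).

Lemma smP m n : m = n :> nat -> m = n.
Proof.
case: m n => [m hm] [n hn] /= e; case: n / e hn => hn.
by congr Submonoid; exact: Prop_irrelevance.
Qed.

Lemma smMC m n : smM m n = smM n m.
Proof. by apply: smP; rewrite /= mulnC. Qed.

End Submonoid.

Section CharacterOperations.
Context (k C : fieldType).

Section Power.
Context (P : prime_set) (nu : submonoid P) (chi : character k C).

Lemma chi_pow0 : chi 0 ^+ nu = 0.
Proof. by rewrite chi0 expr0n gtn_eqF ?sm_gt0. Qed.

Lemma chi_pow1 : chi 1 ^+ nu = 1.
Proof. by rewrite chi1 expr1n. Qed.

Lemma chi_powM : {morph (fun x => chi x ^+ nu) : x y / x * y}.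
Proof. by move=> x y /=; rewrite chiM exprMn. Qed.

Definition chi_pow : character k C := Character chi_pow0 chi_pow1 chi_powM.

Lemma chi_frob0 : chi (0 ^+ nu) = 0.
Proof. by rewrite expr0n gtn_eqF ?sm_gt0 // chi0. Qed.

Lemma chi_frob1 : chi (1 ^+ nu) = 1.
Proof. by rewrite expr1n chi1. Qed.

Lemma chi_frobM : {morph (fun x => chi (x ^+ nu)) : x y / x * y}.
Proof. by move=> x y /=; rewrite exprMn chiM. Qed.

Definition chi_frob : character k C :=
  Character chi_frob0 chi_frob1 chi_frobM.

Lemma chiX (x : k) (n : nat) : chi (x ^+ n) = chi x ^+ n.
Proof. by elim: n => [|n IH]; rewrite ?chi1 // !exprS chiM IH. Qed.

Lemma chi_frobE : chi_frob = chi_pow.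
Proof. by apply: characterP => x /=; rewrite chiX. Qed.

End Power.

Section Pullback.
Context (k' : fieldType) (tau : {rmorphism k' -> k}) (chi : character k C).

Lemma chi_comp0 : chi (tau 0) = 0. Proof. by rewrite rmorph0 chi0. Qed.

Lemma chi_comp1 : chi (tau 1) = 1. Proof. by rewrite rmorph1 chi1. Qed.

Lemma chi_compM : {morph (fun x => chi (tau x)) : x y / x * y}.
Proof. by move=> x y /=; rewrite rmorphM chiM. Qed.

Definition chi_comp : character k' C :=
  Character chi_comp0 chi_comp1 chi_compM.

End Pullback.

End CharacterOperations.

Definition torsion (k : fieldType) (x : k) : Prop :=
  exists2 n : nat, (0 < n)%N & x ^+ n = 1.

Definition cond_Tors (P : prime_set) (k C : fieldType) (chi : character k C) :=
  exists n : submonoid P, [set x : k | torsion x /\ chi x = 1] #= `I_n.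

Definition cond_Image (k C : fieldType) (chi : character k C) :=
  (exists p : nat, p \in [pchar k]) ->
  (forall x : k, x != 0 -> torsion (chi x)) ->
  forall x : k, x != 0 -> torsion x.

Definition E_max (P : prime_set) (C k : fieldType)
  (chi : character k C) : Prop :=
  [/\ GRing.closed_field_axiom k, cond_Tors P chi & cond_Image chi].

Record admissible_class (P : prime_set) (C : fieldType) := AdmissibleClass {
  adm :> forall k : fieldType, character k C -> Prop;
  adm_closed : forall (k : fieldType) (chi : character k C),
    adm chi -> GRing.closed_field_axiom k;
  adm_iso : forall (k k' : fieldType) (tau : {rmorphism k' -> k})
    (chi : character k C), bijective tau -> adm chi <-> adm (chi_comp tau chi);
  adm_pow : forall (k : fieldType) (chi : character k C) (nu : submonoid P),
    adm chi <-> adm (chi_pow nu chi);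
  adm_tors : forall (k : fieldType) (chi : character k C),
    adm chi -> cond_Tors P chi }.

(** * The spaces of C-valued points *)

Definition has_residue_char (X : scheme) (K : fieldType)
  (F : function_field X K) (p : nat) : Prop :=
  exists x : X, p \in [pchar kappa F x].

Definition finite_residue (X : scheme) (K : fieldType)
  (F : function_field X K) : set X :=
  [set x | finite_set [set: kappa F x]].

Definition residue_norm (X : scheme) (K : fieldType) (F : function_field X K)
  (x : X) : nat := #|` fset_set [set: kappa F x]|%fset.

Section Points.
Context (R : realType).
Context (X0 : scheme) (K0 : fieldType) (F0 : function_field X0 K0).
Context (K : fieldType) (iota : {rmorphism K0 -> K}).
Context (X : normalization F0 iota) (act : galois_action X).
Context (P : prime_set) (C : fieldType) (E : admissible_class P C).

Record dotX := DotX {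
  dot_pt : X;
  dot_chi : character (kappa (nz_field X) dot_pt) C }.

Definition dotF (nu : submonoid P) (p : dotX) : dotX :=
  DotX (chi_frob nu (dot_chi p)).

(* [q = p ^ sigma]; the isomorphism kappa(x^sigma) -> kappa(x) is induced by
   [sigma], which maps the local ring at x^sigma onto that at x. *)
Definition dot_conj (sigma : galois iota) (p q : dotX) : Prop :=
  dot_pt q = act sigma (dot_pt p) /\
  forall a : K, a \in stalk (nz_field X) (dot_pt q) ->
    dot_chi q (residue (stalk (nz_field X) (dot_pt q)) a)
    = dot_chi p (residue (stalk (nz_field X) (dot_pt p)) (sigma a)).

Record dotXE := DotXE {
  dotE_val :> dotX;
  dotE_in : E _ (dot_chi dotE_val) }.

Lemma dotFE_in (nu : submonoid P) (p : dotXE) : E _ (dot_chi (dotF nu p)).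
Proof.
rewrite /= chi_frobE.
have h := dotE_in p.
exact: (proj1 (adm_pow E _ nu) h).
Qed.

Definition dotFE (nu : submonoid P) (p : dotXE) : dotXE :=
  DotXE (dotFE_in nu p).

Lemma dotXEP (p q : dotXE) : dotE_val p = dotE_val q -> p = q.
Proof.
case: p q => [p hp] [q hq] /= e; case: q / e hq => hq.
by congr DotXE; exact: Prop_irrelevance.
Qed.

Lemma dotFE1 (p : dotXE) : dotFE (sm1 P) p = p.
Proof.
apply: dotXEP; case: p => -[x chi] h /=; rewrite /dotF /=; congr DotX.
exact: characterP.
Qed.

Lemma dotFEM (mu nu : submonoid P) (p : dotXE) :
  dotFE mu (dotFE nu p) = dotFE (smM mu nu) p.
Proof.
apply: dotXEP; case: p => -[x chi] h /=; rewrite /dotF /=; congr DotX.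
by apply: characterP => y /=; rewrite exprM.
Qed.

(* A pair (nu, p) is the point p placed at the index nu of the colimit, that
   is, F_nu^-1 p. *)
Definition indexed := (submonoid P * dotXE)%type.

HB.instance Definition _ := gen_eqMixin indexed.
HB.instance Definition _ := gen_choiceMixin indexed.

Definition colim_rel (z w : indexed) : bool :=
  `[< exists mu mu' : submonoid P,
        (z.1 * mu = w.1 * mu')%N /\ dotFE mu z.2 = dotFE mu' w.2 >].

Lemma colim_rel_equiv : equiv_class_of colim_rel.
Proof.
split=> [z|z w|w z t].
- by apply/asboolP; exists (sm1 P), (sm1 P).
- by apply/asboolP/asboolP => -[m [m' [e1 e2]]]; exists m', m.
- move=> /asboolP[m [m' [e1 e2]]] /asboolP[l [l' [d1 d2]]].
  apply/asboolP; exists (smM m l), (smM l' m'); split=> /=.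
    by rewrite mulnA e1 mulnAC d1 mulnA.
  rewrite (smMC m l) (smMC l' m') -!dotFEM e2 -d2 !dotFEM.
  by rewrite (smMC l m').
Qed.

Canonical colim_equiv := EquivRelPack colim_rel_equiv.

Definition checkX := {eq_quot colim_rel}.

Definition Fdiv (nu : submonoid P) (p : dotXE) : checkX := \pi_(checkX) (nu, p).

(* F_a F_b^-1 *)
Definition checkF (a b : submonoid P) (c : checkX) : checkX :=
  Fdiv (smM (repr c).1 b) (dotFE a (repr c).2).

Lemma checkX_eqP (nu mu : submonoid P) (p q : dotXE) :
  Fdiv nu p = Fdiv mu q <-> colim_rel (nu, p) (mu, q).
Proof. by split=> [/eqmodP|h]; last exact/eqmodP. Qed.

Lemma checkXP (c : checkX) : exists nu p, c = Fdiv nu p.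
Proof.
exists (repr c).1, (repr c).2.
by rewrite /Fdiv -surjective_pairing reprK.
Qed.

Lemma checkF_Fdiv (a b nu : submonoid P) (p : dotXE) :
  checkF a b (Fdiv nu p) = Fdiv (smM nu b) (dotFE a p).
Proof.
rewrite /checkF.
have : Fdiv (repr (Fdiv nu p)).1 (repr (Fdiv nu p)).2 = Fdiv nu p.
  by rewrite {1}/Fdiv -surjective_pairing reprK.
move: (repr _).1 (repr _).2 => mu q /checkX_eqP/asboolP[m [m' /= [e1 e2]]].
apply/checkX_eqP/asboolP; exists m, m'; split=> /=.
  by rewrite mulnAC e1 mulnAC.
by rewrite !dotFEM (smMC m) (smMC m') -!dotFEM e2.
Qed.

Lemma gact_stalk (sigma : galois iota) (x : X) (a : K) :
  a \in stalk (nz_field X) (act sigma x) ->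
  sigma a \in stalk (nz_field X) x.
Proof.
move=> /stalk_memP[U [nU [s [Ux <-]]]]; apply/stalk_memP.
have nV : nonempty (mor_pre (act sigma) U) by exists x.
exists (mor_pre (act sigma) U), nV, (mor_sec (act sigma) U s).
by split=> //; exact: gact_germ.
Qed.

Lemma dot_conj1 (p : dotX) : dot_conj (galois1 iota) p p.
Proof. by split; rewrite ?gact1. Qed.

Lemma dot_conjM (sigma tau : galois iota) (p q r : dotX) :
  dot_conj sigma p q -> dot_conj tau q r -> dot_conj (galoisM sigma tau) p r.
Proof.
move=> [e h] [d k]; split; first by rewrite gactM -e.
by move=> a ha; rewrite k // h //; apply: gact_stalk; rewrite -d.
Qed.

Lemma dot_conjV (sigma : galois iota) (p q : dotX) :
  dot_conj sigma p q -> dot_conj (galoisV sigma) q p.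
Proof.
have mulV x : act (galoisV sigma) (act sigma x) = x.
  by rewrite -gactM galoisMV gact1.
move=> [e h]; have d : dot_pt p = act (galoisV sigma) (dot_pt q).
  by rewrite e mulV.
split=> // a ha.
by rewrite h /= ?galVK //; apply: (@gact_stalk (galoisV sigma)); rewrite -d.
Qed.

Lemma dot_conjF (sigma : galois iota) (nu : submonoid P) (p q : dotX) :
  dot_conj sigma p q -> dot_conj sigma (dotF nu p) (dotF nu q).
Proof.
by move=> [e h]; split=> //= a ha; rewrite !chiX; congr (_ ^+ _); exact: h.
Qed.

(* (F_nu^-1 p)^sigma = F_nu^-1 (p^sigma) *)
Definition orbit_rel (c d : checkX) : bool :=
  `[< exists (sigma : galois iota) (nu : submonoid P) (p q : dotXE),
        [/\ dot_conj sigma p q, c = Fdiv nu p & d = Fdiv nu q] >].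

Lemma orbit_rel_equiv : equiv_class_of orbit_rel.
Proof.
have sym c d : orbit_rel c d -> orbit_rel d c.
  move=> /asboolP[sigma [nu [p [q [h -> ->]]]]].
  apply/asboolP; exists (galoisV sigma), nu, q, p.
  by split=> //; exact: dot_conjV.
split=> [c|c d|d c e].
- have [nu [p ->]] := checkXP c; apply/asboolP.
  by exists (galois1 iota), nu, p, p; split=> //; exact: dot_conj1.
- by apply/idP/idP; exact: sym.
- move=> /asboolP[sigma [nu [p [q [h -> ->]]]]].
  move=> /asboolP[tau [mu [q' [r [k]]]]].
  move=> /checkX_eqP/asboolP[m [m' /= [e1 e2]]] ->.
  apply/asboolP; exists (galoisM sigma tau), (smM nu m).
  exists (dotFE m p), (dotFE m' r).
  split.
  + apply: dot_conjM (dot_conjF m h) _.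
    have -> : dotF m q = dotF m' q' by have := congr1 dotE_val e2.
    exact: dot_conjF.
  + apply/checkX_eqP/asboolP; exists m, (sm1 P); rewrite dotFE1; split=> //=.
    by rewrite muln1.
  + apply/checkX_eqP/asboolP; exists m', (sm1 P); rewrite dotFE1; split=> //=.
    by rewrite muln1 e1.
Qed.

Canonical orbit_equiv := EquivRelPack orbit_rel_equiv.

Definition checkX0 := {eq_quot orbit_rel}.

Definition orbit (c : checkX) : checkX0 := \pi_(checkX0) c.

Definition checkF0 (a b : submonoid P) (c : checkX0) : checkX0 :=
  orbit (checkF a b (repr c)).

Lemma orbit_eqP (c d : checkX) : orbit c = orbit d <-> orbit_rel c d.
Proof. by split=> [/eqmodP|h]; last exact/eqmodP. Qed.

Lemma checkF0_orbit (a b : submonoid P) (c : checkX) :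
  checkF0 a b (orbit c) = orbit (checkF a b c).
Proof.
rewrite /checkF0; have : orbit (repr (orbit c)) = orbit c by exact: reprK.
move: (repr _) => d /orbit_eqP/asboolP[sigma [nu [p [q [h -> ->]]]]].
rewrite !checkF_Fdiv; apply/orbit_eqP/asboolP.
exists sigma, (smM nu b), (dotFE a p), (dotFE a q); split=> //.
exact: dot_conjF.
Qed.

Lemma checkX0P (c : checkX0) : exists nu p, c = orbit (Fdiv nu p).
Proof.
have [nu [p e]] := checkXP (repr c).
by exists nu, p; rewrite -e /orbit reprK.
Qed.

Lemma Fdiv_eq (nu mu m : submonoid P) (p q : dotXE) :
  (nu * m)%N = mu :> nat -> dotFE m p = q -> Fdiv nu p = Fdiv mu q.
Proof.
move=> e <-; apply/checkX_eqP/asboolP; exists m, (sm1 P).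
by rewrite dotFE1 /= muln1.
Qed.

Lemma checkF0M (a b a' b' : submonoid P) (c : checkX0) :
  checkF0 a' b' (checkF0 a b c) = checkF0 (smM a' a) (smM b b') c.
Proof.
have [nu [p ->]] := checkX0P c; rewrite !checkF0_orbit !checkF_Fdiv dotFEM.
by congr orbit; congr Fdiv; apply: smP; rewrite /= mulnA.
Qed.

Lemma checkF0_id (a : submonoid P) (c : checkX0) : checkF0 a a c = c.
Proof.
have [nu [p ->]] := checkX0P c; rewrite checkF0_orbit checkF_Fdiv.
by congr orbit; symmetry; exact: Fdiv_eq.
Qed.

Definition pr_X0 (c : checkX0) : X0 := nz_proj X (dot_pt (repr (repr c)).2).

Lemma pr_X0E (nu : submonoid P) (p : dotXE) :
  pr_X0 (orbit (Fdiv nu p)) = nz_proj X (dot_pt p).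
Proof.
have hF (la mu : submonoid P) (q r : dotXE) :
  Fdiv la r = Fdiv mu q -> dot_pt q = dot_pt r.
  move=> /checkX_eqP/asboolP[m [m' /= [_ e]]].
  by have /= -> := congr1 (fun z : dotXE => dot_pt z) e.
rewrite /pr_X0.
have : orbit (repr (orbit (Fdiv nu p))) = orbit (Fdiv nu p) by exact: reprK.
move: (repr (orbit _)) => d /orbit_eqP/asboolP[sigma [mu [q [r [[e _] -> h]]]]].
have <- : nz_proj X (dot_pt q) = nz_proj X (dot_pt p).
  by rewrite -(gact_over act sigma) -e (hF _ _ _ _ h).
congr (nz_proj X _); apply: (hF mu (repr (Fdiv mu q)).1).
by rewrite {2}/Fdiv -surjective_pairing reprK.
Qed.

(* An element q of the group generated by [P] in the positive rationals is
   written a / b, with a and b in the monoid; (c, u) q = (F_q c, q^-1 u). *)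
Definition pairs := (checkX0 * {posnum R})%type.

HB.instance Definition _ := gen_eqMixin pairs.
HB.instance Definition _ := gen_choiceMixin pairs.

Definition balanced_rel (z w : pairs) : bool :=
  `[< exists a b : submonoid P, w.1 = checkF0 a b z.1 /\
        w.2%:num = (a%:R / b%:R)^-1 * z.2%:num >].

Lemma balanced_rel_equiv : equiv_class_of balanced_rel.
Proof.
have n0 (a : submonoid P) : a%:R != 0 :> R by rewrite pnatr_eq0 gtn_eqF ?sm_gt0.
have sym z w : balanced_rel z w -> balanced_rel w z.
  move=> /asboolP[a [b [e1 e2]]]; apply/asboolP; exists b, a.
  rewrite e1 checkF0M checkF0_id e2; split=> //.
  by rewrite mulrA -invfM mulf_div (mulrC a%:R) divff ?mulf_neq0 //
    invr1 mul1r.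
split=> [z|z w|w z t].
- apply/asboolP; exists (sm1 P), (sm1 P).
  by rewrite checkF0_id divff ?n0 // invr1 mul1r.
- by apply/idP/idP; exact: sym.
- move=> /asboolP[a [b [e1 e2]]] /asboolP[a' [b' [d1 d2]]].
  apply/asboolP; exists (smM a' a), (smM b b').
  rewrite d1 e1 checkF0M d2 e2; split=> //.
  by rewrite mulrA -invfM mulf_div /= !natrM (mulrC b%:R).
Qed.

Canonical balanced_equiv := EquivRelPack balanced_rel_equiv.

Definition flow_space := {eq_quot balanced_rel}.

Definition flow_pt (c : checkX0) (u : {posnum R}) : flow_space :=
  \pi_(flow_space) (c, u).

Definition flow (z : flow_space) (v : {posnum R}) : flow_space :=
  flow_pt (repr z).1 ((repr z).2%:num * v%:num)%:pos.

Lemma flowE (c : checkX0) (u v : {posnum R}) :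
  flow (flow_pt c u) v = flow_pt c (u%:num * v%:num)%:pos.
Proof.
rewrite /flow; have : flow_pt (repr (flow_pt c u)).1 (repr (flow_pt c u)).2
    = flow_pt c u by rewrite {1}/flow_pt -surjective_pairing reprK.
move: (repr _).1 (repr _).2 => d w /eqmodP/asboolP[a [b /= [e1 e2]]].
by apply/eqmodP/asboolP; exists a, b; rewrite /= e1 e2 mulrA.
Qed.

Definition isotropy (z : flow_space) : set {posnum R} :=
  [set v | flow z v = z].

(* The image of the product of the fibre of pr_X0 over x with R_{>0}. *)
Definition Gamma (x : X0) : set flow_space :=
  [set z | exists (c : checkX0) (u : {posnum R}),
    pr_X0 c = x /\ z = flow_pt c u].

End Points.

(* Main.v *)
(** Write [n] for the norm of a closed point [x0] with finite residue field.  A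
    rational number [a/b] fixes the class of [(x, chi)] iff some [sigma] in the
    decomposition group of [x] satisfies [chi(sigma y)^a = chi(y)^b] on
    [kappa(x)].

    Suppose this holds with [a <> b].  On [l]-power roots of unity, [l] prime to
    the characteristic, [sigma] acts by an [l]-adic unit while [chi] is
    injective up to a finite kernel, so [a] and [b] have the same [l]-adic
    valuation.  Hence the characteristic is some [p > 0] and [a/b] is a power of
    [p].  Orbits of [sigma] on [kappa(x)] are finite, so [chi] has torsion image
    and, by (Image), [kappa(x)^*] is torsion.  If [a = p^e b], say, then the
    values of the homomorphism [y |-> sigma(y)^(p^e) / y] have bounded order;
    since [kappa(x)^*] is divisible it is trivial, so [sigma] is a power of the
    absolute Frobenius.  As [sigma] fixes [kappa(x0)], the latter is finite and
    [a/b] is a power of [n].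

    Conversely the Frobenius [y |-> y^n] of [kappa(x)] lifts to some [sigma] in
    the decomposition group, and then [chi(sigma y) = chi(y)^n].  For the lift,
    pack finitely many sections [b_i] over an affine open as the polynomial
    [theta = \sum_i b_i T^i].  The product of [Y - theta'] over the conjugates
    [theta'] of [theta] has Galois invariant coefficients; by normality these
    reduce to elements fixed by Frobenius, so Frobenius permutes the reductions
    of the conjugates and is realized on the [b_i] by some automorphism.  An
    ultrafilter on the Galois group then gives one automorphism that works for
    all sections. *)

Require Import Defs.
From HB Require Import structures.
From mathcomp Require Import all_boot all_order all_algebra.
From mathcomp Require Import zify.
From mathcomp Require Import finmap interval_inference.
From mathcomp Require Import all_classical all_reals topology.
From mathcomp Require finfield.

Set Implicit Arguments.
Unset Strict Implicit.
Unset Printing Implicit Defensive.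

Import Order.TTheory GRing.Theory Num.Theory.
Local Open Scope classical_set_scope.
Local Open Scope card_scope.
Local Open Scope ring_scope.

(** * Automorphisms of an algebraic closure *)

(** Polynomials over the domain of [G] travel in pairs with their images, so the domain needs no
    ring type of its own. *)
Definition conj_polys (K : nzRingType) (G : set (K * K)) (g h : {poly K}) :=
  forall i, G (g`_i, h`_i).

(* A partial homomorphism is represented by its graph, a subset of [K * K]. *)
Record partial_hom (K : nzRingType) (G : set (K * K)) : Prop := PartialHom {
  partial_homB : forall a b c d, G (a, b) -> G (c, d) -> G (a - c, b - d);
  partial_homM : forall a b c d, G (a, b) -> G (c, d) -> G (a * c, b * d);
  partial_hom0 : forall b, G (0, b) -> b = 0 }.

(** The graph extending [G] by [c |-> d]. It makes sense for every [d], but is single-valued only if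
    [d] satisfies the conjugates of all polynomial relations of [c]. *)
Definition adjoin (K : nzRingType) (G : set (K * K)) (c d : K) : set (K * K) :=
  [set z | exists g h, conj_polys G g h /\ z = (g.[c], h.[d])].

Section Extension.
Context (K0 : fieldType) (K : closedFieldType) (iota : {rmorphism K0 -> K}).
Hypothesis K_alg : forall a : K, algebraicOver iota a.

Section OneStep.
Context (G : set (K * K)) (hG : partial_hom G).
Hypothesis G_iota : forall a, G (iota a, iota a).

Lemma phom0 : G (0, 0).
Proof. by have := G_iota 0; rewrite rmorph0. Qed.

Lemma phom1 : G (1, 1).
Proof. by have := G_iota 1; rewrite rmorph1. Qed.

Lemma phomN a b : G (a, b) -> G (- a, - b).
Proof. by move=> h; have := partial_homB hG phom0 h; rewrite !sub0r. Qed.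

Lemma phomD a b c d : G (a, b) -> G (c, d) -> G (a + c, b + d).
Proof.
by move=> h /phomN k; have := partial_homB hG h k; rewrite !opprK.
Qed.

Lemma phom_sum (I : Type) (s : seq I) (f g : I -> K) :
  (forall i, G (f i, g i)) -> G (\sum_(i <- s) f i, \sum_(i <- s) g i).
Proof.
move=> h; elim: s => [|i s IH]; first by rewrite !big_nil; exact: phom0.
by rewrite !big_cons; exact: phomD.
Qed.

Lemma phomX a b n : G (a, b) -> G (a ^+ n, b ^+ n).
Proof.
move=> h; elim: n => [|n IH]; first by rewrite !expr0; exact: phom1.
by rewrite !exprS; exact: partial_homM.
Qed.

(* Evaluate a polynomial over [K0] with root [a] and nonzero constant term. *)
Lemma phom_inj a : G (a, 0) -> a = 0.
Proof.
move=> h; apply/eqP; apply: contraT => a0.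
have [p p0 r] := K_alg a.
elim/poly_ind: p p0 r => [|p k IH]; first by rewrite eqxx.
rewrite rmorphD rmorphM /= map_polyX map_polyC /=.
have [->|k0] := eqVneq k 0; move=> p0.
  rewrite rmorph0 addr0 rootM rootX (negPf a0) orbF; apply: IH => /=.
  by apply: contraNneq p0 => ->; rewrite mul0r add0r.
rewrite /root hornerMXaddC => /eqP e.
have hp : G ((map_poly iota p).[a], (map_poly iota p).[0]).
  rewrite !horner_coef; apply: phom_sum => i; apply: partial_homM => //.
    by rewrite coef_map; exact: G_iota.
  exact: phomX.
have := phomD (partial_homM hG hp h) (G_iota k).
rewrite e mulr0 add0r => /(partial_hom0 hG)/eqP.
by rewrite fmorph_eq0 (negPf k0).
Qed.

Lemma conj_polysB g h g' h' : conj_polys G g h -> conj_polys G g' h' ->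
  conj_polys G (g - g') (h - h').
Proof. by move=> u v i; rewrite !coefB; exact: partial_homB. Qed.

Lemma conj_polysM g h g' h' : conj_polys G g h -> conj_polys G g' h' ->
  conj_polys G (g * g') (h * h').
Proof.
by move=> u v i; rewrite !coefM; apply: phom_sum => j; exact: partial_homM.
Qed.

Lemma conj_polysC a b : G (a, b) -> conj_polys G a%:P b%:P.
Proof. by move=> h i; rewrite !coefC; case: ifP => _ //; exact: phom0. Qed.

Lemma conj_polysXn n : conj_polys G 'X^n 'X^n.
Proof.
move=> i; rewrite !coefXn; case: (i == n); first exact: phom1.
exact: phom0.
Qed.

Lemma conj_polys_size g h : conj_polys G g h -> size h = size g.
Proof.
move=> u; apply/eqP; rewrite eqn_leq; apply/andP; split.
  apply/leq_sizeP => i hi; apply: (partial_hom0 hG).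
  by have := u i; rewrite nth_default.
apply/leq_sizeP => i hi; apply: phom_inj.
by have := u i; rewrite (nth_default _ hi).
Qed.

Lemma sub_adjoin c d : G `<=` adjoin G c d.
Proof.
move=> [a b] h; exists a%:P, b%:P; rewrite !hornerC; split=> //.
exact: conj_polysC.
Qed.

Lemma adjoin_gen c d : adjoin G c d (c, d).
Proof.
exists 'X, 'X; rewrite !hornerX; split=> //.
by rewrite -(expr1 'X); exact: conj_polysXn.
Qed.

Section MinimalPoly.
Context (c d : K) (m1 m2 : {poly K}).
Hypothesis m_conj : conj_polys G m1 m2.
Hypothesis m1_neq0 : m1 != 0.
Hypothesis m1_min : forall g h, conj_polys G g h -> g != 0 -> g.[c] = 0 ->
  (size m1 <= size g)%N.
Hypotheses (m1_root : m1.[c] = 0) (m2_root : m2.[d] = 0).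

(* Pseudo-division by [m1], one leading term at a time, carried out on both
   coordinates simultaneously. *)
Lemma conj_polys_root g h : conj_polys G g h -> g.[c] = 0 -> h.[d] = 0.
Proof.
have [n] := ubnP (size g); elim: n g h => // n IH g h; rewrite ltnS => sz u gc.
have [g0|g0] := eqVneq g 0.
  have := conj_polys_size u; rewrite g0 size_poly0 => /eqP.
  by rewrite size_poly_eq0 => /eqP ->; rewrite horner0.
have le := m1_min u g0 gc.
set k := (size g - size m1)%N.
pose l (p : {poly K}) := p`_(size m1).-1.
pose t (p : {poly K}) := p`_(size g).-1.
have lc1 : l m1 != 0 by rewrite /l -/(lead_coef m1) lead_coef_eq0.
have lc2 : l m2 != 0.
  apply: contraNneq lc1 => e; apply/eqP/phom_inj.
  by have := m_conj (size m1).-1; rewrite -/(l m1) -/(l m2) e.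
have v : conj_polys G ((l m1)%:P * g - (t g)%:P * 'X^k * m1)
                      ((l m2)%:P * h - (t h)%:P * 'X^k * m2).
  apply: conj_polysB; first exact/conj_polysM/u/conj_polysC/m_conj.
  exact/conj_polysM/m_conj/conj_polysM/conj_polysXn/conj_polysC/u.
have s1 : (0 < size m1)%N by rewrite size_poly_gt0.
have sg : (0 < size g)%N by rewrite size_poly_gt0.
have : ((l m2)%:P * h - (t h)%:P * 'X^k * m2).[d] = 0.
  apply: (IH _ _ _ v); last first.
    by rewrite !hornerE gc m1_root !mulr0 subrr.
  apply: leq_trans sz; rewrite -(prednK sg) ltnS; apply/leq_sizeP => j hj.
  rewrite coefB coefCM -mulrA coefCM coefXnM.
  have kj : (k <= j)%N by rewrite /k; lia.
  rewrite ltnNge kj /=.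
  have [->|ne] := eqVneq j (size g).-1.
    have -> : ((size g).-1 - k)%N = (size m1).-1 by rewrite /k; lia.
    by rewrite /l /t mulrC subrr.
  have lt : ((size g).-1 < j)%N by rewrite ltn_neqAle eq_sym ne.
  rewrite nth_default; last by rewrite -(prednK sg).
  rewrite [m1`_ _]nth_default ?mulr0 ?subrr //.
  by rewrite leq_subRL // /k subnK // -(prednK sg).
rewrite !hornerE m2_root mulr0 subr0 => /eqP.
by rewrite mulf_eq0 (negPf lc2) => /eqP.
Qed.

Lemma adjoin_partial_hom : partial_hom (adjoin G c d).
Proof.
split=> [a b a' b' [g [h [u [-> ->]]]] [g' [h' [u' [-> ->]]]]|
         a b a' b' [g [h [u [-> ->]]]] [g' [h' [u' [-> ->]]]]|
         b [g [h [u [e ->]]]]].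
- exists (g - g'), (h - h'); rewrite !hornerE; split=> //.
  exact: conj_polysB.
- exists (g * g'), (h * h'); rewrite !hornerE; split=> //.
  exact: conj_polysM.
- by apply: conj_polys_root u _.
Qed.

End MinimalPoly.

(** The element [d] is a root of the conjugate [m2] of a polynomial [m1] of least degree over the
    domain of [G] that vanishes at [c]. *)
Lemma exists_adjoin c : exists d, partial_hom (adjoin G c d).
Proof.
pose Q n := `[< exists g h,
  [/\ conj_polys G g h, g != 0, g.[c] = 0 & size g = n] >].
have exQ : exists n, Q n.
  have [p p0 r] := K_alg c; exists (size (map_poly iota p)); apply/asboolP.
  exists (map_poly iota p), (map_poly iota p); split=> //.
  - by move=> i; rewrite coef_map; exact: G_iota.
  - by rewrite map_poly_eq0.
  - exact/eqP.
have [n /asboolP[m1 [m2 [u m0 mc sz]]] mn] := ex_minnP exQ.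
have : size m2 != 1.
  rewrite (conj_polys_size u); apply: contra m0 => /size_poly1P[a a0 e].
  by move: mc; rewrite e hornerC => ->; rewrite polyC_eq0.
move/closed_rootP => [d /eqP r]; exists d.
apply: (@adjoin_partial_hom c d m1 m2) => // g h v g0 gc.
by rewrite sz; apply: mn; apply/asboolP; exists g, h.
Qed.

End OneStep.

Lemma partial_hom_total (G0 : set (K * K)) : partial_hom G0 ->
  (forall a, G0 (iota a, iota a)) ->
  exists G : set (K * K), [/\ partial_hom G, G0 `<=` G &
    forall a, exists b, G (a, b)].
Proof.
move=> h0 i0.
(* The inclusion is asked of nonempty [G] only, so that the union of the empty chain satisfies
   [Q]. *)
pose Q (G : set (K * K)) := partial_hom G /\ forall z, G z -> G0 `<=` G.
have chain (F : set (set (K * K))) : F `<=` Q -> total_on F subset ->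
    Q (\bigcup_(G in F) G).
  move=> FQ tot.
  have common z w : (\bigcup_(G in F) G) z -> (\bigcup_(G in F) G) w ->
      exists G, [/\ F G, G z & G w].
    move=> [A FA Az] [B FB Bw]; have [s|s] := tot _ _ FA FB.
      by exists B; split=> //; exact: s.
    by exists A; split=> //; exact: s.
  split; last first.
    move=> z [A FA Az] w /((FQ _ FA).2 _ Az) Aw; exists A => //.
  split=> [a b c d hz hw|a b c d hz hw|b [A FA]].
  - have [A [FA Az Aw]] := common _ _ hz hw.
    by exists A => //; exact: (partial_homB (FQ _ FA).1).
  - have [A [FA Az Aw]] := common _ _ hz hw.
    by exists A => //; exact: (partial_homM (FQ _ FA).1).
  - exact: (partial_hom0 (FQ _ FA).1).
have [G [[hG G0G] max]] := Zorn_bigcup chain.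
(* A maximal [G] is nonempty, as otherwise [G0] would be strictly larger. *)
have {}G0G : G0 `<=` G.
  have [[z /G0G//]|ne] := pselect (exists z, G z).
  have e : G `<` G0.
    split; first by move=> z Gz; case: ne; exists z.
    by move=> s; apply: ne; exists (iota 0, iota 0); apply: s; exact: i0.
  by case: (max _ e); split=> // z _.
exists G; split=> // a.
have iG c : G (iota c, iota c) by apply: G0G.
have [d hd] := exists_adjoin hG iG a.
exists d; apply: contrapT => nG.
apply: (max (adjoin G a d)); last first.
  by split=> // z _; apply: subset_trans G0G _; exact: sub_adjoin.
split; first exact: sub_adjoin.
by move=> s; apply/nG/s; exact: adjoin_gen.
Qed.

Lemma poly_roots (p : {poly K}) : p != 0 ->
  exists rs : seq K, forall z, root p z = (z \in rs).
Proof.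
move=> p0; have [rs e] := closed_field_poly_normal p; exists rs => z.
by rewrite {1}e rootZ ?lead_coef_eq0 // root_prod_XsubC.
Qed.

Lemma endo_root (f : {rmorphism K -> K}) : (forall a, f (iota a) = iota a) ->
  forall a, exists2 rs : seq K, a \in rs & forall z, z \in rs -> f z \in rs.
Proof.
move=> fi a; have [p p0 r] := K_alg a.
have [|rs e] := @poly_roots (map_poly iota p); first by rewrite map_poly_eq0.
exists rs => [|z]; rewrite -!e // => h.
have -> : map_poly iota p = map_poly f (map_poly iota p).
  by rewrite -map_poly_comp; apply: eq_map_poly => b /=; rewrite fi.
by rewrite fmorph_root.
Qed.

(** Surjectivity: [f] is injective and maps the finite set of roots of a polynomial over [K0] into
    itself, hence permutes it. *)
Lemma endo_galois (f : {rmorphism K -> K}) : (forall a, f (iota a) = iota a) ->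
  exists sigma : galois iota, sigma =1 f.
Proof.
move=> fi.
have ex b : exists a, f a == b.
  have [rs br fr] := endo_root fi b.
  have [] := @uniq_min_size _ (map f (undup rs)) (undup rs).
  - by rewrite map_inj_uniq ?undup_uniq //; exact: fmorph_inj.
  - by move=> _ /mapP[z zr ->]; rewrite mem_undup fr // -mem_undup.
  - by rewrite size_map.
  - move=> _ /(_ b); rewrite mem_undup br => /mapP[a _ ->].
    by exists a.
pose g b := xchoose (ex b).
have fg : cancel g f by move=> b; exact/eqP/(xchooseP (ex b)).
have gf : cancel f g by move=> a; apply: (fmorph_inj f); rewrite fg.
have gB : zmod_morphism g.
  by move=> a b; apply: (fmorph_inj f); rewrite rmorphB !fg.
have gM : monoid_morphism g.
  split; first by apply: (fmorph_inj f); rewrite fg rmorph1.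
  by move=> a b; apply: (fmorph_inj f); rewrite rmorphM !fg.
pose gA := GRing.isZmodMorphism.Build K K g gB.
pose gm := GRing.isMonoidMorphism.Build K K g gM.
pose g' : {rmorphism K -> K} := HB.pack g gA gm.
by exists (@Galois K0 K iota f g' gf fg fi).
Qed.

(** As [f] has least degree among the polynomials killing [c], the assignment [c |-> d] extends the
    identity of [K0]. Zorn's lemma extends it further to an endomorphism of [K], which is an
    automorphism. *)
Lemma galois_transitive (c d : K) (f : {poly K0}) :
  f != 0 -> root (map_poly iota f) c ->
  (forall g : {poly K0}, g != 0 -> root (map_poly iota g) c ->
    (size f <= size g)%N) ->
  root (map_poly iota f) d -> exists sigma : galois iota, sigma c = d.
Proof.
move=> f0 fc fmin fd.
pose D : set (K * K) := [set (iota a, iota a) | a in [set: K0]].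
have hD : partial_hom D.
  split=> [_ _ _ _ [a _ [<- <-]] [b _ [<- <-]]|
           _ _ _ _ [a _ [<- <-]] [b _ [<- <-]]|b [a _ [e <-]]].
  - by exists (a - b) => //; rewrite rmorphB.
  - by exists (a * b) => //; rewrite rmorphM.
  - exact: e.
have iD a : D (iota a, iota a) by exists a.
have pD g h : conj_polys D g h -> exists p, g = map_poly iota p.
  move=> u; have /choice[a ha] : forall i, exists a, iota a = g`_i.
    by move=> i; have [a _ [e _]] := u i; exists a.
  exists (\poly_(i < size g) a i); apply/polyP => i.
  rewrite coef_map coef_poly.
  have [h1|h1] := ltnP i (size g); first by rewrite -ha.
  by rewrite nth_default //; exact/esym/rmorph0.
have hA : partial_hom (adjoin D c d).
  apply: (adjoin_partial_hom hD iD (m1 := map_poly iota f)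
    (m2 := map_poly iota f)); rewrite ?map_poly_eq0 //; try exact/eqP.
    by move=> i; rewrite coef_map; exact: iD.
  move=> g h /pD[p ->]; rewrite map_poly_eq0 => p0 /eqP pc.
  by rewrite !size_map_poly; exact: fmin.
have [|G [hG AG tot]] := partial_hom_total hA.
  by move=> a; apply: sub_adjoin (iD a).
have [s hs] := choice tot.
have iG a : G (iota a, iota a) by exact/AG/sub_adjoin.
have uG a b b' : G (a, b) -> G (a, b') -> b = b'.
  move=> h h'; have := partial_homB hG h h'; rewrite subrr.
  by move/(partial_hom0 hG)/eqP; rewrite subr_eq0 => /eqP.
have sB : zmod_morphism s.
  by move=> a b; apply: (uG (a - b)) => //; exact: (partial_homB hG).
have sM : monoid_morphism s.
  split; first by apply: (uG 1) => //; have := iG 1; rewrite rmorph1.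
  by move=> a b; apply: (uG (a * b)) => //; exact: (partial_homM hG).
pose sA := GRing.isZmodMorphism.Build K K s sB.
pose sm := GRing.isMonoidMorphism.Build K K s sM.
pose s' : {rmorphism K -> K} := HB.pack s sA sm.
have [|sigma e] := @endo_galois s'; first by move=> a; exact: uG (hs _) (iG a).
exists sigma; rewrite e; apply: uG (hs c) _.
by apply: AG; exact: adjoin_gen.
Qed.

Lemma galois_finite (a : K) :
  exists rs : seq K, forall sigma : galois iota, sigma a \in rs.
Proof.
have [p p0 r] := K_alg a.
have [|rs e] := @poly_roots (map_poly iota p); first by rewrite map_poly_eq0.
exists rs => sigma; rewrite -e.
have -> : map_poly iota p = map_poly sigma (map_poly iota p).
  by rewrite -map_poly_comp; apply: eq_map_poly => b /=; rewrite gal_fix.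
by rewrite fmorph_root.
Qed.

(** By transitivity [c] is the only root of its minimal polynomial. The exponent allows for purely
    inseparable [c], which need not come from [K0]. *)
Lemma galois_fixed_poly (c : K) : (forall sigma : galois iota, sigma c = c) ->
  exists (f : {poly K0}) (n : nat), map_poly iota f = ('X - c%:P) ^+ n.+1.
Proof.
move=> fix_c.
pose Q n := `[< exists f : {poly K0},
  [/\ f != 0, root (map_poly iota f) c & size f = n] >].
have exQ : exists n, Q n.
  by have [p p0 r] := K_alg c; exists (size p); apply/asboolP; exists p.
have [n /asboolP[f [f0 fc sz]] mn] := ex_minnP exQ.
have fi0 : map_poly iota f != 0 by rewrite map_poly_eq0.
have [rs e] := closed_field_poly_normal (map_poly iota f).
have {}rc z : z \in rs -> z = c.
  move=> zr; have [] := @galois_transitive c z f f0 fc.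
  - by move=> g g0 gc; rewrite sz; apply: mn; apply/asboolP; exists g.
  - by rewrite e rootZ ?lead_coef_eq0 // root_prod_XsubC.
  - by move=> sigma <-.
have crs : c \in rs.
  by move: fc; rewrite e rootZ ?lead_coef_eq0 // root_prod_XsubC.
exists ((lead_coef f)^-1 *: f), (size rs).-1.
rewrite linearZ /= e fmorphV lead_coef_map scalerA mulVf ?scale1r; last first.
  by rewrite fmorph_eq0 lead_coef_eq0.
rewrite prednK; last by case: (rs) crs.
rewrite (eq_big_seq (fun=> 'X - c%:P)); last by move=> z /rc ->.
by rewrite big_const_seq count_predT iter_mulr_1.
Qed.

End Extension.

(** * Lifting automorphisms of a residue field *)

Lemma coef_map_poly2 (A B : nzRingType) (f : {rmorphism A -> B})
  (p : {poly {poly A}}) i j : (map_poly (map_poly f) p)`_i`_j = f p`_i`_j.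
Proof. by rewrite (coef_map (map_poly f)) coef_map. Qed.

Section FrobeniusLift.
Context (K0 : fieldType) (K : closedFieldType) (iota : {rmorphism K0 -> K}).
Hypothesis K_alg : forall a : K, algebraicOver iota a.
Context (S : comNzRingType) (v : {rmorphism S -> K}).
Hypothesis v_inj : injective v.
Hypothesis v_stable : forall (sigma : galois iota) (s : S),
  exists t, v t = sigma (v s).
Context (k : fieldType) (rho : {rmorphism S -> k}) (phi : {rmorphism k -> k}).
Hypothesis phi_base : forall (s : S) (a : K0), v s = iota a ->
  phi (rho s) = rho s.

(** The hypothesis [phi_base] covers only elements coming from [K0], but some power of ['X - s%:P]
    has all its coefficients there. So [phi] fixes the reduction of this power and maps its only
    root [rho s] to itself. *)
Lemma phi_fix (s : S) : (forall sigma : galois iota, sigma (v s) = v s) ->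
  phi (rho s) = rho s.
Proof.
move=> /(galois_fixed_poly K_alg)[f [n e]].
pose g : {poly S} := ('X - s%:P) ^+ n.+1.
have gE (A : nzRingType) (h : {rmorphism S -> A}) :
    map_poly h g = ('X - (h s)%:P) ^+ n.+1.
  by rewrite rmorphXn rmorphB /= map_polyX map_polyC.
have g_fix : map_poly phi (map_poly rho g) = map_poly rho g.
  apply/polyP => i; rewrite !coef_map /=; apply: (@phi_base _ f`_i).
  by rewrite -!coef_map gE e.
have : root (map_poly rho g) (rho s) by rewrite gE rootE !hornerE subrr expr0n.
move=> /(rmorph_root phi); rewrite g_fix gE rootE !hornerE expf_eq0 subr_eq0.
by move=> /eqP.
Qed.

Lemma galois_seq_finite (l : seq K) :
  finite_set [set map sigma l | sigma in [set: galois iota]].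
Proof.
elim: l => [|a l IH].
  apply: (sub_finite_set (B := [set [::]])); last exact: finite_set1.
  by move=> _ [sigma _ <-].
have [rs ars] := galois_finite K_alg a.
apply: (sub_finite_set (B := [set x :: y | x in [set` rs]
  & y in [set map sigma l | sigma in [set: galois iota]]])).
  move=> _ [sigma _ <-]; exists (sigma a); first exact: ars.
  by exists (map sigma l) => //; exists sigma.
exact/finite_image2/IH/finite_seq.
Qed.

Lemma frobenius_lift_seq (bs : seq S) : exists sigma : galois iota,
  forall s t, s \in bs -> v t = sigma (v s) -> rho t = phi (rho s).
Proof.
pose theta := Poly bs.
pose O := [set eta : {poly S} | exists sigma : galois iota,
  map_poly v eta = map_poly sigma (map_poly v theta)].
have vP_inj : injective (map_poly v).
  exact: map_inj_poly v_inj (rmorph0 v).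
have finO : finite_set O.
  have h : finite_set (map_poly v @^-1` [set Poly l |
      l in [set map sigma (map v bs) | sigma in [set: galois iota]]]).
    apply: finite_preimage; first by move=> ? ? _ _; exact: vP_inj.
    exact/finite_image/galois_seq_finite.
  apply: sub_finite_set h => eta [sigma e]; rewrite /preimage/= e.
  exists (map sigma (map v bs)); first by exists sigma.
  by rewrite /theta !map_Poly.
pose es : seq {poly S} := fset_set O.
have esP eta : (eta \in es) = (eta \in O) by rewrite in_fset_set.
pose F := \prod_(eta <- es) ('X - eta%:P).
have F_map (T : comNzRingType) (f : {rmorphism {poly S} -> T}) :
    map_poly f F = \prod_(x <- map f es) ('X - x%:P).
  rewrite rmorph_prod big_map; apply: eq_bigr => eta _.
  by rewrite rmorphB /= map_polyX map_polyC.
have F_fix (sigma : galois iota) i j : sigma (v F`_i`_j) = v F`_i`_j.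
  have : map_poly (map_poly sigma) (map_poly (map_poly v) F) =
      map_poly (map_poly v) F.
    (* By [v_stable], [sigma] maps conjugates of [theta] to conjugates with coefficients in [S].
       Being injective on a finite set, it permutes them and fixes the coefficients of [F]. *)
    have sub : {subset map (map_poly sigma \o map_poly v) es
        <= map (map_poly v) es}.
      move=> x /mapP[eta]; rewrite esP => /set_mem[tau e] -> {x} /=.
      have /choice[c hc] : forall n, exists t, v t = sigma (v eta`_n).
        by move=> n; exact: v_stable.
      have e' : map_poly v (\poly_(n < size eta) c n) =
          map_poly sigma (map_poly v eta).
        apply/polyP => n; rewrite !coef_map coef_poly /=.
        have [h|h] := ltnP n (size eta); first by rewrite hc.
        by rewrite [eta`_n]nth_default // !rmorph0.
      rewrite -e'; apply/map_f; rewrite esP; apply/mem_set.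
      exists (galoisM sigma tau); rewrite e' e -map_poly_comp.
      exact: eq_map_poly.
    have uniqM : uniq (map (map_poly sigma \o map_poly v) es).
      rewrite map_inj_uniq ?fset_uniq //; apply: inj_comp vP_inj.
      exact: map_inj_poly (fmorph_inj sigma) (rmorph0 sigma).
    have [|_ eqM] := uniq_min_size uniqM sub; first by rewrite !size_map.
    rewrite -map_poly_comp !F_map; apply: perm_big; apply: uniq_perm => //.
    by rewrite map_inj_uniq ?fset_uniq.
  move=> /(congr1 (fun p : {poly {poly K}} => p`_i`_j)).
  by rewrite !coef_map_poly2.
have Fr_fix : map_poly (map_poly phi) (map_poly (map_poly rho) F) =
    map_poly (map_poly rho) F.
  by apply/polyP => i; apply/polyP => j; rewrite !coef_map /=; exact: phi_fix.
(* [theta] is one of its own conjugates. Since [phi] fixes the reduction of [F], it maps the root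
   given by [theta] to another root, which is the reduction of some conjugate [eta]. *)
have : root (map_poly (map_poly rho) F) (map_poly rho theta).
  rewrite F_map root_prod_XsubC; apply/map_f; rewrite esP; apply/mem_set.
  by exists (galois1 iota); rewrite map_poly_id.
move=> /(rmorph_root (map_poly phi)); rewrite Fr_fix F_map root_prod_XsubC.
move=> /mapP[eta]; rewrite esP => /set_mem[sigma e] h.
exists sigma => s t /(nthP 0)[i _ <-].
rewrite -coef_Poly -/theta => vt.
have {vt} -> : t = eta`_i.
  by apply: v_inj; rewrite vt; move/(congr1 (fun p : {poly _} => p`_i)): e;
    rewrite !coef_map.
by move/(congr1 (fun p : {poly _} => p`_i)): h; rewrite !coef_map.
Qed.

(** A compactness argument: the sets [W bs] generate a proper filter by the finite case, and an
    ultrafilter refining it has a pointwise limit [f]. *)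
Lemma frobenius_lift : exists sigma : galois iota,
  forall s t, v t = sigma (v s) -> rho t = phi (rho s).
Proof.
pose W (bs : seq S) : set (galois iota) := [set sigma |
  forall s t, s \in bs -> v t = sigma (v s) -> rho t = phi (rho s)].
pose F : set_system (galois iota) := [set A | exists bs, W bs `<=` A].
have FF : ProperFilter F.
  split.
    move=> [bs h]; have [sigma hs] := frobenius_lift_seq bs; exact: (h sigma).
  split; first by exists [::].
  - move=> A B [bs hA] [cs hB]; exists (bs ++ cs) => sigma hs; split.
      by apply: hA => s t sb; apply: hs; rewrite mem_cat sb.
    by apply: hB => s t sb; apply: hs; rewrite mem_cat sb orbT.
  - by move=> A B AB [bs h]; exists bs; exact: subset_trans AB.
have [U [UU FU]] := ultraFilterLemma FF.
have PU : ProperFilter U by exact: ultra_proper.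
(* The orbit of [a] is finite, so the ultrafilter selects one of its values. *)
have lim a : exists b, U [set sigma | sigma a = b].
  have [rs ars] := galois_finite K_alg a.
  have : U [set sigma : galois iota | sigma a \in rs].
    by apply: filterS filterT => sigma _; exact: ars.
  elim: rs {ars} => [|b rs IH] h.
    by have [sigma] := filter_ex h.
  have [hb|hb] := in_ultra_setVsetC [set sigma : galois iota | sigma a = b] UU.
    by exists b.
  apply: IH; apply: filterS (filterI h hb) => sigma [/=].
  by rewrite inE => /orP[/eqP|].
have [f hf] := choice lim.
have ev a (Q : set K) : U [set sigma : galois iota | Q (sigma a)] -> Q (f a).
  move=> h; have [sigma [/= q e]] := filter_ex (filterI h (hf a)).
  by rewrite -e.
have fB : zmod_morphism f.
  move=> a b; apply: (ev _ (eq^~ (f a - f b))).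
  apply: filterS (filterI (hf a) (hf b)) => sigma [/= <- <-]; exact: rmorphB.
have fM : monoid_morphism f.
  split.
    apply: (ev _ (eq^~ 1)); apply: filterS filterT => sigma _; exact: rmorph1.
  move=> a b; apply: (ev _ (eq^~ (f a * f b))).
  apply: filterS (filterI (hf a) (hf b)) => sigma [/= <- <-]; exact: rmorphM.
pose fA := GRing.isZmodMorphism.Build K K f fB.
pose fm := GRing.isMonoidMorphism.Build K K f fM.
pose f' : {rmorphism K -> K} := HB.pack f fA fm.
have [|sigma e] := @endo_galois _ _ _ K_alg f'.
  move=> a; apply: (ev _ (eq^~ (iota a))).
  by apply: filterS filterT => sigma _; exact: gal_fix.
exists sigma => s t; rewrite e /= => vt.
have UW : U (W [:: s]) by apply: FU; exists [:: s].
have [tau [/= Wt et]] := filter_ex (filterI UW (hf (v s))).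
by apply: Wt; rewrite ?inE // et.
Qed.

End FrobeniusLift.

(* Polynomials require a nontrivial coefficient ring, whereas section rings are
   typed as pzRings. *)
Lemma comPzRing_nz (A : comPzRingType) : (1 : A) <> 0 ->
  exists S : comNzRingType, (S : comPzRingType) = A.
Proof.
case: A => T [m1 m2 m3 m4 m5 m6 m7 m8 m9 m10 m11] /eqP n.
pose A := GRing.ComPzRing.Pack (GRing.ComPzRing.Class m4 m11).
pose m := GRing.PzSemiRing_isNonZero.Build A n.
pose S : comNzRingType := HB.pack T A m.
by exists S.
Qed.

(** * Characters of algebraically closed fields *)

Lemma closed_nth_root (k : fieldType) (n : nat) (a : k) :
  GRing.closed_field_axiom k -> (0 < n)%N -> exists y, y ^+ n = a.
Proof.
move=> kc n0; have [y e] := kc n (fun i => if i == 0%N then a else 0) n0.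
exists y; rewrite e (bigD1 (Ordinal n0)) //= mulr1 big1 ?addr0 // => i.
by rewrite -val_eqE /= => /negPf ->; rewrite mul0r.
Qed.

(** A root [w] of [1 + X + ... + X^(l-1)] differs from 1 because [l] is nonzero in [k]. An
    [l ^ t]-th root of [w] then has exact order [l ^ t.+1]. *)
Lemma prim_root_exists (k : fieldType) (l t : nat) :
  GRing.closed_field_axiom k -> prime l -> l \notin [pchar k] ->
  exists z : k, (l ^ t.+1).-primitive_root z.
Proof.
move=> kc pl lk; have l0 : l%:R != 0 :> k by move: lk; rewrite inE pl.
have l1 := prime_gt1 pl.
have : size (\poly_(i < l) (1 : k)) != 1%N.
  by rewrite size_poly_eq ?oner_neq0 //; apply: contraTneq l1 => ->.
move=> /(PreClosedField.closed_rootP kc)[w];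
  rewrite /root horner_poly => /eqP w0.
have {}w0 : \sum_(i < l) w ^+ i = 0.
  by rewrite -[RHS]w0; apply: eq_bigr => i _; rewrite mul1r.
have wl : w ^+ l = 1 by apply/eqP; rewrite -subr_eq0 subrX1 w0 mulr0.
have w1 : w != 1.
  apply: contraNneq l0 => w1; rewrite -[X in _ == X]w0 w1; apply/eqP.
  rewrite (eq_bigr (fun=> 1)); first by rewrite sumr_const card_ord.
  by move=> i _; rewrite expr1n.
have [|z zw] := closed_nth_root w kc (n := (l ^ t)%N).
  by rewrite expn_gt0 prime_gt0.
have zl : z ^+ (l ^ t.+1) = 1 by rewrite expnSr exprM zw.
have [|m zm /dvdn_pfactor] := prim_order_exists _ zl.
  by rewrite expn_gt0 prime_gt0.
case/(_ pl) => j jt em; exists z; move: zm; rewrite em.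
move: jt; rewrite leq_eqVlt => /orP[/eqP -> //|]; rewrite ltnS => jt.
move=> /prim_order_dvd/(_ (l ^ t)%N); rewrite zw (negPf w1) => /negbT.
by rewrite dvdn_exp2l.
Qed.

Lemma logn_eq_mod (l t x y : nat) : prime l -> (0 < x)%N -> (0 < y)%N ->
  (logn l x <= t)%N -> (logn l y <= t)%N -> x = y %[mod l ^ t.+1] ->
  logn l x = logn l y.
Proof.
move=> pl x0 y0 hx hy e.
have dv i : (i <= t.+1)%N -> (l ^ i %| x)%N = (l ^ i %| y)%N.
  move=> h; have d := dvdn_exp2l l h.
  by rewrite /dvdn -(modn_dvdm x d) e modn_dvdm.
apply/eqP; rewrite eqn_leq -!pfactor_dvdn //.
by rewrite -dv ?pfactor_dvdnn ?dv ?pfactor_dvdnn // leqW.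
Qed.

Lemma torsion_exponent (k : fieldType) (A : set k) : finite_set A ->
  (forall z, A z -> torsion z) ->
  exists2 M : nat, (0 < M)%N & forall z, A z -> z ^+ M = 1.
Proof.
move=> /finite_seqP[s ->]; elim: s => [|a s IH] h; first by exists 1%N.
have [|M M0 hM] := IH; first by move=> z zs; apply: h; rewrite /= inE zs orbT.
have [|n n0 an] := h a; first by rewrite /= inE eqxx.
exists (n * M)%N; first by rewrite muln_gt0 n0.
move=> z; rewrite /= inE => /orP[/eqP ->|zs]; first by rewrite exprM an expr1n.
by rewrite mulnC exprM hM // expr1n.
Qed.

Lemma pchar_rmorph (k k' : fieldType) (f : {rmorphism k -> k'}) :
  [pchar k'] =i [pchar k].
Proof.
by move=> p; rewrite !inE -(rmorph_nat f) fmorph_eq0.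
Qed.

Lemma divisible_torsion_trivial (k : fieldType) (h : k -> k) (M : nat) :
  GRing.closed_field_axiom k -> (0 < M)%N -> {morph h : x y / x * y} ->
  (forall y, y != 0 -> h y ^+ M = 1) -> forall y, y != 0 -> h y = 1.
Proof.
move=> kc M0 hM ht.
have h1 : h 1 = 1.
  have e := hM 1 1; rewrite mulr1 in e; have n0 : h 1 != 0.
    by apply: contra_eq_neq (ht 1 (oner_neq0 _)) => ->;
      rewrite expr0n gtn_eqF // eq_sym oner_neq0.
  by apply: (mulfI n0); rewrite mulr1 -e.
move=> y y0; have [w wy] := closed_nth_root y kc M0.
have w0 : w != 0 by apply: contraNneq y0 => e; rewrite -wy e expr0n gtn_eqF.
rewrite -wy -[RHS](ht w w0); move: (M) => n.
by elim: n => [|n IH]; rewrite ?expr0 // !exprS hM IH.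
Qed.

Section Characters.
Context (k C : fieldType) (P : prime_set) (chi : character k C).
Hypothesis k_closed : GRing.closed_field_axiom k.
Hypothesis chi_tors : cond_Tors P chi.

Lemma chi_neq0 x : x != 0 -> chi x != 0.
Proof.
move=> x0; have : chi x * chi x^-1 = 1 by rewrite -chiM divff // chi1.
by apply: contra_eq_neq => ->; rewrite mul0r eq_sym oner_neq0.
Qed.

Lemma chi_div x y : y != 0 -> chi (x / y) = chi x / chi y.
Proof.
by move=> y0; apply: (mulIf (chi_neq0 y0)); rewrite -chiM !divfK ?chi_neq0.
Qed.

Lemma chi_kernel_exponent : exists2 M : nat, (0 < M)%N &
  forall z, torsion z -> chi z = 1 -> z ^+ M = 1.
Proof.
have [n hn] := chi_tors.
have [|M M0 hM] := @torsion_exponent k _ (ex_intro _ (n : nat) hn).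
  by move=> z [].
by exists M => // z zt z1; exact: hM.
Qed.

Section Equivariance.
Context (tau : {rmorphism k -> k}) (a b : nat).
Hypotheses (a_gt0 : (0 < a)%N) (b_gt0 : (0 < b)%N).
Hypothesis chi_tau : forall y, chi (tau y) ^+ a = chi y ^+ b.

(* On l-power roots of unity tau is raising to some power prime to l, whereas
   [chi_tau] forces it to be y |-> y^(b/a) up to a finite kernel. *)
Lemma logn_equivariant l : prime l -> l \notin [pchar k] -> logn l a = logn l b.
Proof.
move=> pl lk; have [M M0 hM] := chi_kernel_exponent.
(* This [t] bounds the [l]-adic valuations of [c * a * M] and [b * M], where [c] below is prime to
   [l], so a congruence modulo [l ^ t.+1] compares them. *)
pose t := (logn l M + logn l a + logn l b)%N.
have [z zp] := prim_root_exists t k_closed pl lk.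
have z0 : z != 0.
  by apply: contra_eq_neq (prim_expr_order zp) => ->;
    rewrite expr0n gtn_eqF ?expn_gt0 ?prime_gt0 // eq_sym oner_neq0.
have [|[c _] /= zc] := prim_rootP zp (x := tau z).
  by rewrite -rmorphXn (prim_expr_order zp) rmorph1.
have cl : ~~ (l %| c)%N.
  apply/negP => /dvdnP[d cd].
  have : tau (z ^+ (l ^ t)) = 1.
    rewrite rmorphXn zc cd -exprM -mulnA -expnS mulnC exprM.
    by rewrite (prim_expr_order zp) expr1n.
  move=> /eqP; rewrite fmorph_eq1 -(prim_order_dvd zp) dvdn_Pexp2l
    ?prime_gt1 //.
  by rewrite ltnn.
have c0 : (0 < c)%N by case: (c) cl; rewrite ?dvdn0.
(* Since [tau z = z ^+ c], the relation [chi_tau] puts this quotient in the torsion of the kernel of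
   [chi], which [M] kills. *)
have : (z ^+ (c * a) / z ^+ b) ^+ M = 1.
  apply: hM.
    exists (l ^ t.+1)%N; first by rewrite expn_gt0 prime_gt0.
    by rewrite exprMn exprVn -!exprM !(mulnC _ (l ^ _)%N) !exprM
      (prim_expr_order zp) !expr1n divr1.
  rewrite chi_div ?expf_neq0 // exprM -zc !chiX chi_tau.
  by rewrite divff // expf_neq0 // chi_neq0.
rewrite exprMn exprVn -!exprM => /(canRL (divfK _)).
rewrite expf_neq0 // mul1r => /(_ isT)/eqP.
rewrite (eq_prim_root_expr zp) => /eqP e.
have := logn_eq_mod pl _ _ _ _ e; rewrite !lognM ?muln_gt0 ?c0 ?a_gt0 ?b_gt0
  ?M0 //.
rewrite (lognE l c) pl c0 (negPf cl) /= => /(_ isT isT).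
rewrite /t => H; have := H _ _; lia.
Qed.

Lemma equivariant_ratio : a != b -> exists (p e : nat), [/\ p \in [pchar k],
  (0 < e)%N & a = (p ^ e * b)%N \/ b = (p ^ e * a)%N].
Proof.
move=> ab.
have [p pk] : exists p, p \in [pchar k].
  apply: contrapT => np; move/eqP: ab; apply.
  apply: eqn_from_log => // l; have [pl|npl] := boolP (prime l).
    by apply: logn_equivariant => //; apply/negP => lk; apply: np; exists l.
  by rewrite /= (lognE l a) (lognE l b) (negPf npl).
have pp := pcharf_prime pk.
have e' : (a`_p^' = b`_p^')%N.
  apply: eq_partn_from_log => // l lp /=.
  have [pl|npl] := boolP (prime l);
    last by rewrite (lognE l a) (lognE l b) (negPf npl).
  apply: logn_equivariant => //; apply: contra lp => lk.
  by move: lk; rewrite (pcharf_eq pk).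
have part n : (0 < n)%N -> (n = p ^ logn p n * n`_p^')%N.
  by move=> n0; rewrite -p_part partnC.
have [lt|lt|e] := ltngtP (logn p a) (logn p b).
- exists p, (logn p b - logn p a)%N; split; rewrite ?subn_gt0 //; right.
  transitivity (p ^ (logn p b - logn p a) * (p ^ logn p a * a`_p^'))%N.
    by rewrite mulnA -expnD subnK ?(ltnW lt) // e' -part.
  by rewrite -part.
- exists p, (logn p a - logn p b)%N; split; rewrite ?subn_gt0 //; left.
  transitivity (p ^ (logn p a - logn p b) * (p ^ logn p b * b`_p^'))%N.
    by rewrite mulnA -expnD subnK ?(ltnW lt) // -e' -part.
  by rewrite -part.
- by move/eqP: ab; case; rewrite (part a) // (part b) // e e'.
Qed.

Hypothesis tau_periodic : forall y, exists2 n, (0 < n)%N & iter n tau y = y.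

(** Going once around a [tau]-orbit of length [n] gives [chi y ^+ (a ^ n) = chi y ^+ (b ^ n)] with
    distinct exponents. *)
Lemma chi_image_torsion : a != b -> forall y, y != 0 -> torsion (chi y).
Proof.
move=> ab y y0; have [n n0 ny] := tau_periodic y.
have e m : chi (iter m tau y) ^+ (a ^ m) = chi y ^+ (b ^ m).
  elim: m => [|m IH] //=.
  by rewrite expnS exprM chi_tau -exprM mulnC exprM IH -exprM -expnSr.
have := e n; rewrite ny => {}e.
have c0 := chi_neq0 y0.
have ne : (a ^ n != b ^ n)%N by rewrite eqn_exp2r.
have key u w : (u < w)%N -> chi y ^+ u = chi y ^+ w -> torsion (chi y).
  move=> uw euw; exists (w - u)%N; first by rewrite subn_gt0.
  apply: (mulIf (expf_neq0 u c0)).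
  by rewrite -exprD subnK ?mul1r ?euw // ltnW.
by case: (ltngtP (a ^ n)%N (b ^ n)%N) ne => // h _;
  [exact: key e|apply: key h _].
Qed.

Hypothesis chi_image : cond_Image chi.

(** The quotient [f / g] is a homomorphism whose [m]-th power has values in the torsion kernel of
    [chi]. Its values thus have bounded order, and divisibility makes it trivial. *)
Lemma eq_of_chi_eq (f g : k -> k) (m : nat) : (0 < m)%N ->
  (forall y : k, y != 0 -> torsion y) ->
  {morph f : x y / x * y} -> {morph g : x y / x * y} ->
  (forall y, y != 0 -> f y != 0) -> (forall y, y != 0 -> g y != 0) ->
  (forall y, y != 0 -> chi (f y) ^+ m = chi (g y) ^+ m) ->
  forall y, y != 0 -> f y = g y.
Proof.
move=> m0 tors fM gM f0 g0 e y y0; have [M M0 hM] := chi_kernel_exponent.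
have : f y / g y = 1; last by move/(canRL (divfK (g0 _ y0))); rewrite mul1r.
apply: (divisible_torsion_trivial (h := fun y => f y / g y) (M := (m * M)%N))
  => //.
- by rewrite muln_gt0 m0.
- by move=> u w; rewrite fM gM mulf_div.
move=> {y0}y y0; rewrite exprM; apply: hM.
  by apply: tors; rewrite expf_neq0 // mulf_neq0 ?invr_eq0 ?f0 ?g0.
by rewrite chiX chi_div
  ?g0 // exprMn exprVn e // divff // expf_neq0 // chi_neq0 // g0.
Qed.

(** The first alternative says that [tau] is inverse to a power of Frobenius, the second that it is
    such a power. *)
Lemma equivariant_frobenius : a != b -> exists (p e : nat), [/\ p \in [pchar k],
  (0 < e)%N &
  (a = (p ^ e * b)%N /\ forall y, tau y ^+ (p ^ e) = y) \/
  (b = (p ^ e * a)%N /\ forall y, tau y = y ^+ (p ^ e))].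
Proof.
move=> ab; have [p [e [pk e0 h]]] := equivariant_ratio ab.
have tors : forall y : k, y != 0 -> torsion y.
  by apply: chi_image; [exists p|exact: chi_image_torsion].
have q0 : (0 < p ^ e)%N by rewrite expn_gt0 prime_gt0 ?(pcharf_prime pk).
have XM (n : nat) : {morph (fun y : k => y ^+ n) : x y / x * y}.
  by move=> x y; rewrite exprMn.
have t0 (y : k) : y != 0 -> tau y != 0 by rewrite fmorph_eq0.
exists p, e; split=> //; case: h => h; [left|right]; split=> // y.
  have [->|y0] := eqVneq y 0; first by rewrite rmorph0 expr0n gtn_eqF.
  apply: (@eq_of_chi_eq (fun y => tau y ^+ (p ^ e)) id b) y0 => //.
  - by move=> u w; rewrite rmorphM XM.
  - by move=> u u0; rewrite expf_neq0 ?t0.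
  - by move=> u u0; rewrite chiX -exprM -h chi_tau.
have [->|y0] := eqVneq y 0; first by rewrite rmorph0 expr0n gtn_eqF.
apply: (@eq_of_chi_eq tau (fun y => y ^+ (p ^ e)) a) y0 => //.
- exact: rmorphM.
- by move=> u u0; rewrite expf_neq0.
- by move=> u u0; rewrite chiX -exprM -h chi_tau.
Qed.

End Equivariance.
End Characters.

(** * Finite fields and power maps fixing all their elements *)

Lemma size_XnsubX (k0 : fieldType) (n : nat) : (1 < n)%N ->
  size ('X^n - 'X : {poly k0}) = n.+1.
Proof.
by move=> n1; rewrite size_polyDl ?size_polyN ?size_polyX !size_polyXn.
Qed.

Lemma expr_fixed_card (k0 : fieldType) (n : nat) (B : {fset k0}) : (1 < n)%N ->
  (forall y : k0, y ^+ n = y) -> (#|` B| <= n)%N.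
Proof.
move=> n1 h; rewrite -ltnS -(size_XnsubX k0 n1); apply: max_poly_roots.
- by rewrite -size_poly_gt0 size_XnsubX.
- by apply/allP => y _; rewrite rootE !hornerE h subrr.
- exact: fset_uniq.
Qed.

Lemma finite_of_expr_fixed (k0 : fieldType) (n : nat) : (1 < n)%N ->
  (forall y : k0, y ^+ n = y) -> finite_set [set: k0].
Proof.
move=> n1 h; apply: contrapT => /(infinite_set_fset n.+1)[B _ sz].
by have := expr_fixed_card B n1 h; rewrite leqNgt sz.
Qed.

Section FiniteField.
Context (k0 : fieldType) (k0_fin : finite_set [set: k0]).
Let N := #|` fset_set [set: k0]|%fset.

Lemma finite_field_model : exists (F : finFieldType) (f : {rmorphism k0 -> F}),
  #|F| = N.
Proof.
pose e : seq k0 := fset_set [set: k0].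
have ein x : x \in e by rewrite in_fset_set // inE.
(* Positions in the enumeration [e] make the carrier countable, as a [finFieldType] requires. The
   map [g] to the resulting [F] is the identity. *)
have eK : pcancel (index^~ e) (onth e).
  by move=> x; rewrite onthE (nth_map x) ?index_mem // nth_index.
have eA : Finite.axiom e.
  by move=> x; rewrite count_uniq_mem ?fset_uniq // ein.
pose c := @PCanIsCountable nat k0 _ _ eK.
pose f := isFinite.Build k0 eA.
pose F : finFieldType := HB.pack k0 c f.
pose g : k0 -> F := id.
have gB : zmod_morphism g by [].
have gM : monoid_morphism g by [].
pose ga := GRing.isZmodMorphism.Build k0 F g gB.
pose gm := GRing.isMonoidMorphism.Build k0 F g gM.
pose f0 : {rmorphism k0 -> F} := HB.pack g ga gm; exists F, f0.
rewrite cardE /N; apply: (perm_size (s2 := e)); apply: uniq_perm.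
- exact: enum_uniq.
- exact: fset_uniq.
- by move=> x; rewrite ein; exact: (@mem_enum F F x).
Qed.

Lemma finite_field_expf_card (y : k0) : y ^+ N = y.
Proof.
have [F [f <-]] := finite_field_model; apply: (fmorph_inj f).
by rewrite rmorphXn finfield.expf_card.
Qed.

Lemma finite_field_card : exists2 p, p \in [pchar k0] &
  exists2 f, (0 < f)%N & N = (p ^ f)%N.
Proof.
have [F [g <-]] := finite_field_model.
have [p _ pF] := finfield.finPcharP F; exists p;
  first by rewrite -(pchar_rmorph g).
have e := finfield.card_pprimeChar pF; exists (logn p #|F|) => //.
rewrite lt0n; apply: contraTneq (finfield.finNzRing_gt1 F) => h.
by rewrite e h.
Qed.

(** With [N = p ^ f], the exponent [e] may be reduced modulo [f]. A nonzero remainder [r] would give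
    [N] roots of a polynomial of degree [p ^ r < N]. *)
Lemma finite_field_expr_fixed (p e : nat) : p \in [pchar k0] ->
  (forall y : k0, y ^+ (p ^ e) = y) -> exists m, (p ^ e = N ^ m)%N.
Proof.
move=> pk h; have [p' pk' [f f0 Nf]] := finite_field_card.
have ep : p' = p by have := pcharf_eq pk' p; rewrite pk inE => /esym/eqP.
rewrite ep in Nf; have pp := pcharf_prime pk.
have pow i (y : k0) : y ^+ (p ^ (f * i)) = y.
  elim: i => [|i IH]; first by rewrite muln0.
  by rewrite mulnS expnD exprM -Nf finite_field_expf_card.
have r0 : (e %% f)%N = 0%N.
  apply/eqP; apply: contraT; rewrite -lt0n => r0.
  have n1 : (1 < p ^ (e %% f))%N by rewrite -(exp1n (e %% f)) ltn_exp2r //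
    prime_gt1.
  have hr (y : k0) : y ^+ (p ^ (e %% f)) = y.
    by rewrite -[RHS]h {2}(divn_eq e f) expnD exprM mulnC pow.
  have := expr_fixed_card (fset_set [set: k0]) n1 hr.
  by rewrite -/N Nf leq_exp2l ?prime_gt1 // leqNgt ltn_mod f0.
exists (e %/ f)%N; rewrite {1}(divn_eq e f) r0 addn0 mulnC expnM.
by rewrite Nf.
Qed.

End FiniteField.

(** * Residue fields of the normalization *)

Section Residue.
Local Open Scope quotient_scope.
Context (K : fieldType) (A : local_subring K).

Lemma residue_val (u : lsub A) : residue A (val u) = \pi_(residue_field A) u.
Proof. by rewrite /residue valKd. Qed.

Lemma residueB a b : a \in lsub_mem A -> b \in lsub_mem A ->
  residue A (a - b) = residue A a - residue A b.
Proof.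
move=> ha hb; rewrite (residue_val (LSub ha)) (residue_val (LSub hb)).
by rewrite -rmorphB; exact: (residue_val (LSub ha - LSub hb)).
Qed.

Lemma residueM a b : a \in lsub_mem A -> b \in lsub_mem A ->
  residue A (a * b) = residue A a * residue A b.
Proof.
move=> ha hb; rewrite (residue_val (LSub ha)) (residue_val (LSub hb)).
by rewrite -rmorphM; exact: (residue_val (LSub ha * LSub hb)).
Qed.

Lemma residue1 : residue A 1 = 1.
Proof. by rewrite (residue_val 1) rmorph1. Qed.

Lemma residueX a n : a \in lsub_mem A -> residue A (a ^+ n) = residue A a ^+ n.
Proof.
move=> ha; elim: n => [|n IH]; first by rewrite residue1.
by rewrite !exprS residueM ?IH ?rpredX.
Qed.

Lemma residue_surj (y : residue_field A) :
  exists2 a, a \in lsub_mem A & residue A a = y.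
Proof.
exists (val (repr y)); first exact: valP.
by rewrite residue_val reprK.
Qed.

Lemma residue_eq0 a : a \in lsub_mem A ->
  (residue A a == 0) = (a == 0) || (a^-1 \notin lsub_mem A).
Proof.
move=> ha; rewrite (residue_val (LSub ha)).
have <- : (LSub ha \in @lsub_nonunit K A) = (a == 0) || (a^-1 \notin lsub_mem
  A).
  by rewrite lsub_nonunitE.
rewrite -(rmorph0 \pi_(residue_field A)).
by apply/eqP/idP => [/eqmodP|h]; last apply/eqmodP;
  rewrite /= Quotient.equivE subr0.
Qed.

End Residue.

(** The second hypothesis is locality of [f]: nonunits go to nonunits, so the value on a
    representative is well defined in the residue field. *)
Lemma residue_rmorph (K L : fieldType) (A : local_subring K)
    (B : local_subring L) (f : {rmorphism K -> L}) :
  (forall a, a \in lsub_mem A -> f a \in lsub_mem B) ->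
  (forall a, a \in lsub_mem A -> (f a)^-1 \in lsub_mem B ->
    a^-1 \in lsub_mem A) ->
  exists g : {rmorphism residue_field A -> residue_field B},
    forall a, a \in lsub_mem A -> g (residue A a) = residue B (f a).
Proof.
move=> fA fl.
pose g (y : residue_field A) := residue B (f (val (repr y))).
have gE a : a \in lsub_mem A -> g (residue A a) = residue B (f a).
  move=> ha; rewrite /g; set u := repr _.
  have hu := valP u.
  apply/eqP; rewrite -subr_eq0 -residueB ?fA // -rmorphB residue_eq0 ?fA
    ?rpredB //.
  have : residue A (val u - a) == 0.
    by rewrite residueB // residue_val reprK subrr.
  rewrite residue_eq0 ?rpredB // fmorph_eq0 => /orP[->//|h].
  by apply/orP; right; apply: contra h; apply: fl; rewrite rpredB.
have gB : zmod_morphism g.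
  move=> y z; have [a ha <-] := residue_surj y;
    have [b hb <-] := residue_surj z.
  by rewrite -residueB // !gE ?rpredB // rmorphB residueB ?fA.
have gM : monoid_morphism g.
  split; first by rewrite -(residue1 A) gE ?rpred1 // rmorph1 residue1.
  move=> y z; have [a ha <-] := residue_surj y;
    have [b hb <-] := residue_surj z.
  by rewrite -residueM // !gE ?rpredM // rmorphM residueM ?fA.
pose ga := GRing.isZmodMorphism.Build _ _ g gB.
pose gm := GRing.isMonoidMorphism.Build _ _ g gM.
pose g' : {rmorphism residue_field A -> residue_field B} := HB.pack g ga gm.
by exists g'.
Qed.

Section Normalization.
Context (X0 : scheme) (K0 : fieldType) (F0 : function_field X0 K0).
Context (K : closedFieldType) (iota : {rmorphism K0 -> K}).
Context (X : normalization F0 iota).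
Local Notation nonempty := Defs.nonempty.
Local Notation FX := (nz_field X).
Local Notation pi := (nz_proj X).

Lemma proj_stalk (x : X) a : a \in stalk F0 (pi x) -> iota a \in stalk FX x.
Proof.
move=> /stalk_memP[U [nU [s [Ux <-]]]]; apply/stalk_memP.
have nV : nonempty (mor_pre pi U) by exists x.
exists (mor_pre pi U), nV, (mor_sec pi U s); split=> //.
exact: nz_proj_germ.
Qed.

Lemma proj_stalk_local (x : X) a : a \in stalk F0 (pi x) ->
  (iota a)^-1 \in stalk FX x -> a^-1 \in stalk F0 (pi x).
Proof.
have [->|a0] := eqVneq a 0; first by move=> h _; rewrite invr0.
move=> /stalk_memP[U [nU [s [Ux e]]]] h.
have nV : nonempty (mor_pre pi U) by exists x.
rewrite -e; apply: (proj1 (germ_unitP F0 nU s Ux) _).2.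
apply: mor_local => //; apply/(germ_unitP FX nV) => //.
by rewrite nz_proj_germ e fmorph_eq0.
Qed.

Lemma kappa_proj (x : X) : exists j : {rmorphism kappa F0 (pi x) -> kappa FX x},
  forall a, a \in stalk F0 (pi x) ->
    j (residue (stalk F0 (pi x)) a) = residue (stalk FX x) (iota a).
Proof.
by apply: residue_rmorph => a; [exact: proj_stalk|exact: proj_stalk_local].
Qed.

Lemma residue_unit (V : opens X) (nV : nonempty V) (x : X) (s : sec V) : V x ->
  germ_unit s x <-> residue (stalk FX x) (germ FX nV s) != 0.
Proof.
move=> Vx; have sx : germ FX nV s \in stalk FX x.
  by apply/stalk_memP; exists V, nV, s.
rewrite residue_eq0 // negb_or negbK.
by split=> [/(germ_unitP FX nV _ Vx)/andP//|/andP h]; apply/(germ_unitP FX nV).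
Qed.

Lemma residue_section (V : opens X) (nV : nonempty V) (x : X) : V x ->
  exists rho : {rmorphism sec V -> kappa FX x},
    forall s, rho s = residue (stalk FX x) (germ FX nV s).
Proof.
move=> Vx; have sx (s : sec V) : germ FX nV s \in stalk FX x.
  by apply/stalk_memP; exists V, nV, s.
pose r (s : sec V) : kappa FX x := residue (stalk FX x) (germ FX nV s).
have rB : zmod_morphism r by move=> s t; rewrite /r rmorphB residueB.
have rM : monoid_morphism r.
  by split=> [|s t]; rewrite /r ?rmorph1 ?residue1 // rmorphM residueM.
pose ra := GRing.isZmodMorphism.Build _ _ r rB.
pose rm := GRing.isMonoidMorphism.Build _ _ r rM.
pose rho : {rmorphism sec V -> kappa FX x} := HB.pack r ra rm.
by exists rho.
Qed.

(** Around [x] there is a distinguished open D(s) on which the germ is defined, and sections over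
    D(s) are fractions with a power of [s] as denominator. *)
Lemma stalk_fraction (V : opens X) (nV : nonempty V) (x : X) (a : K) :
  affine_open V -> V x -> a \in stalk FX x ->
  exists (s t : sec V) (n : nat), residue (stalk FX x) (germ FX nV s) != 0 /\
    a * germ FX nV s ^+ n = germ FX nV t.
Proof.
move=> aV Vx /stalk_memP[W [nW [w [Wx <-]]]].
have [s [sx sW]] := affine_basis aV Vx Wx.
have nD : nonempty (basic_open s) by exists x.
have [n [t e]] := affine_surj aV (res sW w).
exists s, t, n; split; first by apply/residue_unit => //; exact: sx.2.
move/(congr1 (germ FX nD)): e; rewrite rmorphM rmorphXn.
by rewrite !(germ_res FX _ nD).
Qed.

Context (act : galois_action X).

Lemma gact_stalkE (sigma : galois iota) (x : X) (a : K) :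
  (sigma a \in stalk FX x) = (a \in stalk FX (act sigma x)).
Proof.
apply/idP/idP => h; last exact: gact_stalk h.
have : gal (galoisV sigma) (sigma a) \in stalk FX (act sigma x).
  by apply: (gact_stalk (act := act) (sigma := galoisV sigma));
    rewrite -gactM galoisMV gact1.
by rewrite /= galK.
Qed.

Lemma kappa_gact (sigma : galois iota) (x : X) : act sigma x = x ->
  exists g : {rmorphism kappa FX x -> kappa FX x},
  forall a, a \in stalk FX x ->
    g (residue (stalk FX x) a) = residue (stalk FX x) (sigma a).
Proof.
move=> fx; apply: residue_rmorph => a /= h.
  by have := gact_stalkE sigma x a; rewrite fx => ->.
by have := gact_stalkE sigma x a^-1; rewrite fx fmorphV => ->.
Qed.

(** A point of an affine open is determined by its prime. The nonunits at [x] form a prime because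
    they are the kernel of the evaluation [r] into a field. *)
Lemma affine_point_eq (V : opens X) (nV : nonempty V) (x y : X) :
  affine_open V -> V x -> V y ->
  (forall s : sec V, germ_unit s x <-> germ_unit s y) -> x = y.
Proof.
move=> aV Vx Vy e.
have [r rE] := residue_section nV Vx.
have pE (s : sec V) : [set s | ~ germ_unit s x] s <-> r s = 0.
  rewrite rE; split=> [h|h /(residue_unit nV s Vx)]; last by rewrite h eqxx.
  by apply/eqP/negPn/negP => /(residue_unit nV s Vx); exact: h.
have [|z [_ uz]] := affine_bij aV (p := [set s | ~ germ_unit s x]).
  split=> [|s t /pE hs /pE ht|s t /pE ht|/pE|s t /pE].
  - by apply/pE; rewrite rmorph0.
  - by apply/pE; rewrite rmorphD hs ht addr0.
  - by apply/pE; rewrite rmorphM ht mulr0.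
  - by rewrite rmorph1 => /eqP; rewrite oner_eq0.
  - rewrite rmorphM => /eqP; rewrite mulf_eq0.
    by case/orP=> /eqP h; [left|right]; apply/pE.
rewrite -(uz x) // (uz y) //; split=> //.
by apply/seteqP; split=> s /= h k; apply/h/e.
Qed.

End Normalization.

(** * Frobenius elements in decomposition groups *)

Section FrobeniusElement.
Context (X0 : scheme) (K0 : fieldType) (F0 : function_field X0 K0).
Context (K : closedFieldType) (iota : {rmorphism K0 -> K}).
Hypothesis X0_normal : normal_scheme F0.
Hypothesis K_alg : forall a : K, algebraicOver iota a.
Context (X : normalization F0 iota) (act : galois_action X).
Local Notation nonempty := Defs.nonempty.
Local Notation FX := (nz_field X).
Local Notation pi := (nz_proj X).

Lemma frobenius_lift_pz (A : comPzRingType) (v : {rmorphism A -> K})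
    (k : fieldType) (rho : {rmorphism A -> k}) (phi : {rmorphism k -> k}) :
  (1 : A) <> 0 -> injective v ->
  (forall (sigma : galois iota) s, exists t, v t = sigma (v s)) ->
  (forall s a, v s = iota a -> phi (rho s) = rho s) ->
  exists sigma : galois iota,
    forall s t, v t = sigma (v s) -> rho t = phi (rho s).
Proof.
move=> /comPzRing_nz[S e]; case: A / e v rho => v rho.
by move=> vi vs vb; exact: (frobenius_lift K_alg vi vs vb).
Qed.

(** Sections over the preimage of [U] form an integral closure, and [sigma] fixes the coefficients
    of an integral equation over [U]. *)
Lemma section_galois (U : opens X0) (nU : nonempty U)
    (nV : nonempty (mor_pre pi U)) (sigma : galois iota)
    (s : sec (mor_pre pi U)) : affine_open U ->
  exists t : sec (mor_pre pi U), germ FX nV t = sigma (germ FX nV s).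
Proof.
move=> aU; have [p [pm pc pr]] := (nz_closure X nU aU (germ FX nV s)).1
  (ex_intro _ nV (ex_intro _ s erefl)).
have [|nV' [t e]] := (nz_closure X nU aU (sigma (germ FX nV s))).2; last first.
  by exists t; rewrite -e (Prop_irrelevance nV nV').
exists (map_poly sigma p); split.
- exact: monic_map.
- by move=> i; rewrite coef_map /=; have [u _ <-] := pc i; rewrite gal_fix;
    exists u.
- exact: rmorph_root.
Qed.

(** Here normality enters: the integral equation of [iota a] has coefficients from [K0], so it
    descends to one for [a] over the local ring. *)
Lemma section_base (U : opens X0) (nU : nonempty U) (x0 : X0)
    (nV : nonempty (mor_pre pi U)) (s : sec (mor_pre pi U)) (a : K0) :
  affine_open U -> U x0 -> germ FX nV s = iota a -> a \in stalk F0 x0.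
Proof.
move=> aU Ux e; apply: X0_normal.
have [p [pm pc pr]] := (nz_closure X nU aU (iota a)).1
  (ex_intro _ nV (ex_intro _ s e)).
have /choice[c hc] : forall i, exists u : sec U, iota (germ F0 nU u) = p`_i.
  by move=> i; have [u _ <-] := pc i; exists u.
have ep : p = map_poly iota (\poly_(i < size p) germ F0 nU (c i)).
  apply/polyP => i; rewrite coef_map coef_poly.
  have [h|h] := ltnP i (size p); first by rewrite -hc.
  by rewrite nth_default //; exact/esym/rmorph0.
exists (\poly_(i < size p) germ F0 nU (c i)); split.
- by rewrite -(map_monic iota) -ep.
- move=> i; rewrite coef_poly; case: ifP => _;
    last exact: (rpred0 (lsub_mem (stalk F0 x0))).
  by apply/stalk_memP; exists U, nU, (c i).
- by rewrite -(fmorph_root iota) -ep.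
Qed.

Lemma frobenius_element (x : X) : finite_residue F0 (pi x) ->
  exists sigma : galois iota, act sigma x = x /\
    forall a, a \in stalk FX x -> residue (stalk FX x) (sigma a) =
      residue (stalk FX x) a ^+ residue_norm F0 (pi x).
Proof.
move=> fin; set N := residue_norm F0 (pi x).
have [j jE] := kappa_proj x.
have [p pk0 [f f0 Nf]] := finite_field_card fin.
have pk : p \in [pchar kappa FX x] by rewrite (pchar_rmorph j).
have Ngt0 : (0 < N)%N by rewrite /N /residue_norm Nf expn_gt0 prime_gt0
  ?(pcharf_prime pk).
pose phi (y : kappa FX x) := y ^+ N.
have phiN : [pchar kappa FX x].-nat N.
  rewrite /N /residue_norm Nf pnatX; apply/orP; left.
  by rewrite (eq_pnat _ (pcharf_eq pk)) pnat_id ?(pcharf_prime pk).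
have phiB : zmod_morphism phi 
  by move=> y z; apply: (addIr (phi z)); rewrite subrK -exprDn_pchar ?subrK.
have phiM : monoid_morphism phi.
  by split=> [|y z]; rewrite /phi ?expr1n ?exprMn.
pose pa := GRing.isZmodMorphism.Build _ _ phi phiB.
pose pm := GRing.isMonoidMorphism.Build _ _ phi phiM.
pose Phi : {rmorphism kappa FX x -> kappa FX x} := HB.pack phi pa pm.
have [U [Ux aU]] := sch_affine (pi x).
have nU : nonempty U by exists (pi x).
pose V := mor_pre pi U; have Vx : V x by [].
have nV : nonempty V by exists x.
have aV : affine_open V by exact: nz_affine.
have [rho rhoE] := residue_section nV Vx.
have [||||sigma hs] := @frobenius_lift_pz (sec V) (germ FX nV) _ rho Phi.
- exact: integral_neq0 (nz_integral X) _ nV.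
- exact: germ_inj.
- by move=> sigma s; exact: section_galois.
(* Sections lying in [K0] reduce into the finite field [kappa F0 (pi x)], where the [N]-th power map
   is the identity. *)
- move=> s a e; rewrite rhoE e -jE; last exact: section_base e.
  by rewrite /= /phi -rmorphXn finite_field_expf_card.
have {}hs s t : germ FX nV t = sigma (germ FX nV s) -> rho t = rho s ^+ N.
  exact: hs.
(* Both points lie in [V] and have the same prime: [rho t = rho s ^+ N] vanishes exactly when
   [rho s] does. *)
have fx : act sigma x = x.
  apply/esym; apply: (affine_point_eq nV aV Vx).
    by rewrite /V /mor_pre /= gact_over.
  move=> s; have [t et] := section_galois nU nV sigma s aU.
  have Vy : V (act sigma x) by rewrite /V /mor_pre /= gact_over.
  have : rho t != 0 <-> rho s != 0.
    by rewrite (hs _ _ et) expf_eq0 Ngt0.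
  rewrite !rhoE -!(residue_unit nV) // => <-.
  split=> [/(germ_unitP FX nV t Vx)[]|/(germ_unitP FX nV s Vy)[]].
    rewrite et fmorph_eq0 -fmorphV (gact_stalkE act) => h1 h2.
    exact/(germ_unitP FX nV s Vy).
  rewrite -gact_stalkE fmorphV -et -(fmorph_eq0 sigma) -et => h1 h2.
  exact/(germ_unitP FX nV t Vx).
(* The congruence passes from sections to the local ring by writing [a] as a fraction with
   denominator invertible at [x]. *)
exists sigma; split=> // a ax.
have [s [t [n [s0 e]]]] := stalk_fraction nV aV Vx ax.
have [s' es'] := section_galois nU nV sigma s aU.
have [t' et'] := section_galois nU nV sigma t aU.
have sx (u : sec V) : germ FX nV u \in stalk FX x.
  by apply/stalk_memP; exists V, nV, u.
have sax : sigma a \in stalk FX x by rewrite (gact_stalkE act) fx.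
have r1 : residue (stalk FX x) a * rho s ^+ n = rho t.
  by rewrite !rhoE -e residueM ?residueX ?rpredX.
have r2 : residue (stalk FX x) (sigma a) * rho s' ^+ n = rho t'.
  by rewrite !rhoE et' -e rmorphM rmorphXn -es' residueM ?residueX ?rpredX.
move: r2; rewrite (hs _ _ es') (hs _ _ et') -r1 exprMn exprAC.
by apply: mulIf; rewrite !expf_neq0 // rhoE.
Qed.

End FrobeniusElement.

(** * Isotropy groups *)

Lemma iter_periodic (T : eqType) (f : T -> T) (a : T) (rs : seq T) :
  injective f -> (forall i, iter i f a \in rs) ->
  exists2 n, (0 < n)%N & iter n f a = a.
Proof.
move=> f_inj h; have : looping f a (size rs).
  apply: contraT; rewrite -looping_uniq => /uniq_leq_size - /(_ rs).
  rewrite size_traject ltnn; apply => _ /trajectP[i _ ->]; exact: h.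
move=> /trajectP[i lt e]; exists (size rs - i)%N; first by rewrite subn_gt0.
have inj_iter m : injective (iter m f).
  by elim: m => [|m IH] // x y /= /f_inj/IH.
by apply: (inj_iter i); rewrite -iterD subnKC ?e // ltnW.
Qed.

Section Isotropy.
Context (R : realType).
Context (X0 : scheme) (K0 : fieldType) (F0 : function_field X0 K0).
Context (K : closedFieldType) (iota : {rmorphism K0 -> K}).
Hypothesis X0_normal : normal_scheme F0.
Hypothesis K_alg : forall a : K, algebraicOver iota a.
Context (X : normalization F0 iota) (act : galois_action X).
Context (P : prime_set) (C : fieldType) (E : admissible_class P C).
Hypothesis P_char : forall p, has_residue_char F0 p -> P p.
Hypothesis E_sub : forall (k : fieldType) (chi : character k C),
  E k chi -> E_max P chi.
Local Notation FX := (nz_field X).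
Local Notation pi := (nz_proj X).

Lemma galois_periodic (sigma : galois iota) (a : K) :
  exists2 n, (0 < n)%N & iter n sigma a = a.
Proof.
have [rs ars] := galois_finite K_alg a.
apply: (iter_periodic (rs := rs)); first exact: fmorph_inj.
move=> i; suff [tau <-] : exists tau : galois iota, tau a = iter i sigma a.
  exact: ars.
elim: i => [|i [tau e]]; first by exists (galois1 iota).
by exists (galoisM sigma tau); rewrite /= e.
Qed.

(** Equality in the colimit holds only after a further transition map; [k] is the resulting common
    factor. *)
Lemma checkF0_fixed (a b nu : submonoid P) (p : dotXE X E) :
  checkF0 a b (Defs.orbit act (Fdiv nu p)) = Defs.orbit act (Fdiv nu p) ->
  exists (sigma : galois iota) (k : submonoid P),
    dot_conj act sigma (dotFE (smM k a) p) (dotFE (smM k b) p).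
Proof.
rewrite checkF0_orbit checkF_Fdiv.
move=> /orbit_eqP/asboolP[sigma [mu [q [r [h]]]]].
move=> /checkX_eqP/asboolP[m [m' /= [e1 e2]]].
move=> /checkX_eqP/asboolP[l [l' /= [d1 d2]]].
exists sigma, (smM l' m).
have := dot_conjF (smM m' l') h.
have -> : dotF (smM m' l') q = dotFE (smM (smM l' m) a) p.
  change (dotE_val (dotFE (smM m' l') q) = dotFE (smM (smM l' m) a) p).
  by rewrite (smMC m') -dotFEM -e2 !dotFEM; congr (dotE_val (dotFE _ p));
    apply: smP; rewrite /= mulnA.
suff -> : dotF (smM m' l') r = dotFE (smM (smM l' m) b) p by [].
change (dotE_val (dotFE (smM m' l') r) = dotFE (smM (smM l' m) b) p).
rewrite -dotFEM -d2 dotFEM; congr (dotE_val (dotFE _ p)); apply: smP => /=.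
have nu0 := sm_gt0 nu; apply/eqP; rewrite -(eqn_pmul2l nu0).
by rewrite mulnCA d1 mulnA (mulnC m') -e1; apply/eqP; lia.
Qed.

Lemma fixed_point_norm (a b nu : submonoid P) (p : dotXE X E) :
  checkF0 a b (Defs.orbit act (Fdiv nu p)) = Defs.orbit act (Fdiv nu p) ->
  a != b :> nat -> finite_residue F0 (pi (dot_pt p)) /\
  exists m, (a = residue_norm F0 (pi (dot_pt p)) ^ m * b :> nat)%N \/
            (b = residue_norm F0 (pi (dot_pt p)) ^ m * a :> nat)%N.
Proof.
move=> /checkF0_fixed[sigma [k [/= /esym fx h]]] ab.
move: h fx; have := dotE_in p; case: p => -[x chi] /= _ hE h fx.
have [kc ct ci] := E_sub hE.
have [g gE] := kappa_gact fx; have [j jE] := kappa_proj x.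
have chi_g y : chi (g y) ^+ (k * a) = chi y ^+ (k * b).
  have [c cx <-] := residue_surj y.
  by rewrite gE // -!chiX; symmetry; exact: h.
have g_per y : exists2 n, (0 < n)%N & iter n g y = y.
  have [c cx <-] := residue_surj y; have [n n0 e] := galois_periodic sigma c.
  exists n => //; rewrite -[in RHS]e.
  suff : iter n sigma c \in stalk FX x /\ iter n g (residue (stalk FX x) c) =
      residue (stalk FX x) (iter n sigma c) by case.
  elim: (n) => [|i [IH1 IH2]] //=.
  by rewrite IH2 gE //; split=> //; rewrite (gact_stalkE act) fx.
have gj y : g (j y) = j y.
  have [c cx <-] := residue_surj y.
  by rewrite jE // gE ?proj_stalk // gal_fix.
have k0 := sm_gt0 k; have a0 := sm_gt0 a; have b0 := sm_gt0 b.
have [|||q [e [qk e0 H]]] := @equivariant_frobenius _ C P chi kc ct g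
  (k * a)%N (k * b)%N _ _ chi_g g_per ci.
- by rewrite muln_gt0 k0.
- by rewrite muln_gt0 k0.
- by rewrite eqn_pmul2l.
have qk0 : q \in [pchar kappa F0 (pi x)] by rewrite -(pchar_rmorph j).
(* On the image of [kappa F0 (pi x)] the map [g] is the identity, while up to inversion it is the
   [q ^ e]-power map. *)
have fixq (y : kappa F0 (pi x)) : y ^+ (q ^ e) = y.
  apply: (fmorph_inj j); rewrite rmorphXn.
  by case: H => -[_ H]; [rewrite -{1}(gj y) H|rewrite -[RHS]gj H].
have fin : finite_residue F0 (pi x).
  apply: finite_of_expr_fixed fixq.
  by rewrite -(exp1n e) ltn_exp2r // prime_gt1 // (pcharf_prime qk).
split=> //; have [m em] := finite_field_expr_fixed fin qk0 fixq.
exists m; rewrite /residue_norm -em.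
by case: H => -[H _]; [left|right]; apply/eqP;
  rewrite -(eqn_pmul2l k0) H mulnCA.
Qed.

(** This makes the norm an index of the monoid acting on the points. *)
Lemma residue_norm_generated (x0 : X0) : finite_residue F0 x0 ->
  (1 < residue_norm F0 x0)%N /\ generated P (residue_norm F0 x0).
Proof.
move=> fin; have [p pk [f f0 Nf]] := finite_field_card fin.
have pp := pcharf_prime pk; rewrite /residue_norm Nf; split.
  by rewrite -(exp1n f) ltn_exp2r // prime_gt1.
exists (nseq f p); last by rewrite big_nseq iter_muln_1.
by move=> q /nseqP[-> _]; apply: P_char; exists x0.
Qed.

(** The Frobenius element [sigma] conjugates [p] to [F_N p]. *)
Lemma checkF0_residue_norm (N nu : submonoid P) (p : dotXE X E) :
  finite_residue F0 (pi (dot_pt p)) ->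
  N = residue_norm F0 (pi (dot_pt p)) :> nat ->
  checkF0 N (sm1 P) (Defs.orbit act (Fdiv nu p)) = Defs.orbit act (Fdiv nu p).
Proof.
move=> fin eN;
  have [sigma [fx hs]] := frobenius_element X0_normal K_alg act fin.
rewrite checkF0_orbit checkF_Fdiv; apply/esym/orbit_eqP/asboolP.
exists sigma, nu, p, (dotFE N p); split=> //; last first.
  by congr Fdiv; apply: smP; rewrite /= muln1.
by split=> //= c cx; rewrite eN -hs.
Qed.

Lemma pr_checkF0 (a b : submonoid P) (c : checkX0 act E) :
  pr_X0 (checkF0 a b c) = pr_X0 c.
Proof.
by have [nu [p ->]] := checkX0P c; rewrite checkF0_orbit checkF_Fdiv !pr_X0E.
Qed.

(** Identifying [(c, u * v)] with [(c, u)] forces [v = a / b]; the factor [u] cancels, so isotropy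
    depends on [c] alone. *)
Lemma isotropyP (c : checkX0 act E) (u v : {posnum R}) :
  isotropy (flow_pt c u) v <-> exists a b : submonoid P,
    checkF0 a b c = c /\ v%:num = a%:R / b%:R.
Proof.
have n0 (a : submonoid P) : a%:R != 0 :> R by rewrite pnatr_eq0 gtn_eqF ?sm_gt0.
have u0 : u%:num != 0 by rewrite gt_eqF.
rewrite /isotropy /= flowE; split.
  move=> /eqmodP/asboolP[a [b /= [e1 e2]]]; exists a, b; split=> //.
  have q0 : a%:R / b%:R != 0 :> R by rewrite mulf_neq0 ?invr_eq0.
  by apply: (mulfI u0); rewrite {2}e2 mulrAC mulVf ?mul1r.
move=> [a [b [e1 e2]]]; apply/eqmodP/asboolP; exists a, b; split=> //=.
have q0 : a%:R / b%:R != 0 :> R by rewrite mulf_neq0 ?invr_eq0.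
by rewrite e2 mulrCA mulVf ?mulr1.
Qed.

Lemma isotropy_Gamma (x : X0) (z : flow_space R act E) :
  finite_residue F0 x -> Gamma x z ->
  isotropy z = [set v | exists n : int, v%:num = (residue_norm F0 x)%:R ^ n].
Proof.
move=> fin [c [u [pr ->]]]; have [nu [p ec]] := checkX0P c.
have {pr} ex : pi (dot_pt p) = x by rewrite -pr ec pr_X0E.
have [N1 Ngen] := residue_norm_generated fin.
have n0 (a : submonoid P) : a%:R != 0 :> R by rewrite pnatr_eq0 gtn_eqF ?sm_gt0.
apply/seteqP; split=> v /=.
  move=> /isotropyP[a [b [fc ->]]].
  have [ab|ab] := eqVneq (a : nat) b.
    by exists 0; rewrite ab divff // expr0z.
  rewrite ec in fc; have [_ [m]] := fixed_point_norm fc ab.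
  rewrite ex => -[e|e]; [exists (m%:Z)|exists (- (m%:Z))].
    by rewrite e natrM mulfK // natrX.
  by rewrite e natrM invfM mulrCA divff // mulr1 natrX -exprnN.
move=> [n en]; apply/isotropyP.
pose N := Submonoid Ngen.
have pow m : exists a : submonoid P,
    a = (residue_norm F0 x ^ m)%N :> nat /\ checkF0 a (sm1 P) c = c.
  elim: m => [|m [a [ea IH]]]; first by exists (sm1 P); rewrite checkF0_id.
  exists (smM N a); rewrite /= ea expnS; split=> //.
  have -> : sm1 P = smM (sm1 P) (sm1 P) by apply: smP.
  rewrite -checkF0M IH ec; apply: checkF0_residue_norm; rewrite ?ex //.
have [a [ea fa]] := pow `|n|%N.
case: n en ea => n en ea.
  by exists a, (sm1 P); split=> //; rewrite en ea natrX divr1.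
(* For a negative exponent, [F_a c = c] is turned into [F_a^-1 c = c]. *)
exists (sm1 P), a; split; last by rewrite en ea natrX mul1r NegzE exprnN.
rewrite -{1}fa checkF0M.
exact: checkF0_id.
Qed.

End Isotropy.

(** That [K] is an algebraic closure is expressed by [closedFieldType] and [K_alg]; the disjoint
    union is a union together with [trivIset]. *)
Theorem theorem6p1 (R : realType)
  (X0 : scheme) (X0_integral : integral_scheme X0)
  (K0 : fieldType) (F0 : function_field X0 K0) (X0_normal : normal_scheme F0)
  (K : closedFieldType) (iota : {rmorphism K0 -> K})
  (K_alg : forall a : K, algebraicOver iota a)
  (X : normalization F0 iota) (act : galois_action X)
  (P : prime_set) (P_char : forall p, has_residue_char F0 p -> P p)
  (C : closedFieldType)
  (C_units : exists c : C, c != 0 /\ ~ torsion c)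
  (C_card : [set: K0] #<= [set: C])
  (C_char : [pchar C] =i pred0 \/
    exists p : nat, p \in [pchar K0] /\ p \in [pchar C])
  (E : admissible_class P C)
  (E_sub : forall (k : fieldType) (chi : character k C),
    E k chi -> E_max P chi) :
  [/\ [set z : flow_space R act E | isotropy z <> [set 1%:pos]]
        = \bigcup_(x in finite_residue F0) Gamma x,
      trivIset (finite_residue F0)
        (fun x : X0 => Gamma x : set (flow_space R act E)) &
      forall (x : X0) (z : flow_space R act E),
        finite_residue F0 x -> Gamma x z ->
        isotropy z =
          [set v | exists n : int, v%:num = (residue_norm F0 x)%:R ^ n]].
Proof.
have iso := @isotropy_Gamma R _ _ _ _ _ X0_normal K_alg X act _ _ _ P_char
  E_sub.
split=> [||x z]; last exact: iso.
  apply/seteqP; split=> z /=.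
    have [c [u ->]] : exists c u, z = flow_pt c u.
      by exists (repr z).1, (repr z).2;
        rewrite /flow_pt -surjective_pairing reprK.
    have [nu [p ec]] := checkX0P c; move=> ne.
    (* If only [a = b] occurred, every isotropy element [a / b] would be 1. *)
    have [a [b [fc ab]]] : exists a b : submonoid P,
        checkF0 a b c = c /\ (a != b :> nat).
      apply: contrapT => nab; apply: ne; apply/seteqP; split=> [v|_ ->].
        move=> /isotropyP[a [b [fc ev]]]; apply/val_inj; rewrite /= ev.
        have [->|ab] := eqVneq (a : nat) b; last by case: nab; exists a, b.
        by rewrite divff // pnatr_eq0 gtn_eqF ?sm_gt0.
      apply/isotropyP; exists (sm1 P), (sm1 P).
      by rewrite checkF0_id divr1.
    rewrite ec in fc *; have [fin _] := fixed_point_norm K_alg E_sub fc ab.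
    exists (nz_proj X (dot_pt p)) => //.
    by exists (Defs.orbit act (Fdiv nu p)), u; rewrite pr_X0E.
  move=> [x fin xz]; rewrite (iso x z fin xz) => /seteqP[h _].
  have [N1 _] := residue_norm_generated P_char fin.
  have N0 : 0 < (residue_norm F0 x)%:R :> R by rewrite ltr0n ltnW.
  (* The norm itself lies in the isotropy group and exceeds 1. *)
  have /h/= : exists n : int, (PosNum N0)%:num = (residue_norm F0 x)%:R ^ n.
    by exists 1; rewrite expr1z.
  move=> /(congr1 (fun v => v%:num))/= /eqP.
  by rewrite pnatr_eq1 gtn_eqF.
(* Disjointness holds because [pr_X0] is invariant under the rational action. *)
move=> x y _ _ [z [[c [u [<- ->]]] [d [w [<-]]]]].
by move=> /eqmodP/asboolP[a [b /= [-> _]]]; rewrite pr_checkF0.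
Qed.
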